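(* Let $A, B \in \mathbb{P}_{2n}(\mathbb{R})$ and let $1 \leq i_1 < \cdots < i_k \leq n$ be any distinct indices. The following statements are equivalent: (i) $\displaystyle\sum_{j=1}^{k} d_{i_j}(A+B) = \sum_{j=1}^{k} d_{i_j}(A)+\sum_{j=1}^{k} d_{j}(B).$ (ii) For all $t \in [0,1]$, we have $\displaystyle\sum_{j=1}^{k} d_{i_j}(A+tB) = \sum_{j=1}^{k} d_{i_j}(A)+t\sum_{j=1}^{k} d_{j}(B).$ (iii) There exist a positive integer $r$ and real numbers $0=a_0<a_1<\cdots<a_r=1$ such that for all $\ell \in \{1,\ldots,r\}$ and $t \in (a_{\ell-1},a_\ell)$ there exists $M(t) \in \operatorname{Sp}(2n,2k)$ such that the columns of $M(t)$ form symplectic eigenvector pairs of $A+tB$ corresponding to the symplectic eigenvalues $d_{i_1}(A+tB),\ldots,d_{i_k}(A+tB)$, and $$\operatorname{Tr}\left[M(t)^T A M(t)\right] = 2\sum_{j=1}^{k} d_{i_j}(A), \qquad \operatorname{Tr}\left[M(t)^T B M(t)\right] = 2\sum_{j=1}^{k} d_{j}(B).$$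
   Context: $\mathbb{P}_{2n}(\mathbb{R})$ is the set of $2n\times 2n$ real symmetric positive definite matrices. $J_{2m} = \begin{pmatrix} 0 & I_m \\ -I_m & 0\end{pmatrix}$, and $J=J_{2n}$. $\operatorname{Sp}(2n)$ is the set of real $2n\times 2n$ matrices $M$ with $M^TJ_{2n}M=J_{2n}$, and $\operatorname{Sp}(2n,2k)$ is the set of real $2n\times 2k$ matrices $M$ with $M^TJ_{2n}M=J_{2k}$. By Williamson's theorem, for $A\in\mathbb{P}_{2n}(\mathbb{R})$ there is $M\in\operatorname{Sp}(2n)$ such that $M^TAM = D\oplus D$ with $D$ an $n\times n$ diagonal matrix with positive diagonal entries $d_1(A)\le\cdots\le d_n(A)$; these numbers are uniquely determined by $A$ and are called the symplectic eigenvalues of $A$. A pair $(u,v)$ of non-zero vectors in $\mathbb{R}^{2n}$ is a symplectic eigenvector pair of $A$ corresponding to a symplectic eigenvalue $d$ of $A$ if $Au = d\,Jv$ and $Av = -d\,Ju$. The columns of $M=[u_1,\ldots,u_k,v_1,\ldots,v_k]\in\operatorname{Sp}(2n,2k)$ form symplectic eigenvector pairs of $A$ corresponding to $d_{i_1}(A),\ldots,d_{i_k}(A)$ if, for each $j=1,\ldots,k$, $(u_j,v_j)$ is a symplectic eigenvector pair of $A$ corresponding to $d_{i_j}(A)$. *)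

(* Defs.v *)
From mathcomp Require Import all_boot all_order all_algebra.
From mathcomp Require Import all_classical all_reals.

Set Implicit Arguments.
Unset Strict Implicit.
Unset Printing Implicit Defensive.

Import Order.TTheory GRing.Theory Num.Theory.
Local Open Scope classical_set_scope.
Local Open Scope ring_scope.

(* The dimension 2m is written m + m throughout, matching the 2 x 2 block
   decomposition; columns u_j, v_j of an element of 'M_(n + n, k + k) are then
   the columns lshift k j and rshift k j. *)

Definition posdefmx (R : realType) (m : nat) : set 'M[R]_m :=
  [set A | A^T = A /\
           forall x : 'cV[R]_m, x != 0 -> 0 < (x^T *m A *m x) ord0 ord0].

Definition sympJ (R : realType) (m : nat) : 'M[R]_(m + m) :=
  block_mx 0 1%:M (- 1%:M) 0.

Definition symplecticmx (R : realType) (n k : nat) :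
    set 'M[R]_(n + n, k + k) :=
  [set M | M^T *m sympJ R n *m M = sympJ R k].

Definition williamson_diag (R : realType) (n : nat) (A : 'M[R]_(n + n))
    (d : 'rV[R]_n) : Prop :=
  [/\ forall j : 'I_n, 0 < d ord0 j,
      forall j l : 'I_n, (j <= l)%N -> d ord0 j <= d ord0 l
    & exists2 M : 'M[R]_(n + n), symplecticmx M &
        M^T *m A *m M = block_mx (diag_mx d) 0 0 (diag_mx d)].

(* For positive definite A, Williamson's theorem says that exactly one row d
   satisfies williamson_diag A d, so the choice operator xget returns it; the
   default value 0 is used only for A without such a normal form.
   Indices are 0-based. *)
Definition symp_eigenval (R : realType) (n : nat) (A : 'M[R]_(n + n))
    (j : 'I_n) : R :=
  xget 0 [set d : 'rV[R]_n | williamson_diag A d] ord0 j.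

Definition symp_eigenpair (R : realType) (n : nat) (A : 'M[R]_(n + n))
    (d : R) (u v : 'cV[R]_(n + n)) : Prop :=
  [/\ u != 0, v != 0,
      A *m u = d *: (sympJ R n *m v)
    & A *m v = - d *: (sympJ R n *m u)].

Definition symp_eigenpair_cols (R : realType) (n k : nat) (A : 'M[R]_(n + n))
    (i : 'I_k -> 'I_n) (M : 'M[R]_(n + n, k + k)) : Prop :=
  forall j : 'I_k,
    symp_eigenpair A (symp_eigenval A (i j))
      (col (lshift k j) M) (col (rshift k j) M).

(* Main.v *)
(* The proof avoids perturbation theory. Write C = A + tB with t > 0, and let M_s
   be a symplectic matrix diagonalising C - sB. The M_s stay bounded as s -> 0+,
   and every limit point M diagonalises C. Pairing the eigenvalue equations of
   M_s and M crosswise gives (d_j(C) - d_j(C - sB)) / s -> b_j along the chosen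
   limit, where 2 b_j is the trace of B on the j-th eigenpair of M.
   By the symplectic Ky Fan inequality the sum of the b_{i_j} is at least
   d_1(B) + ... + d_k(B), so t |-> sum_j d_{i_j}(A + tB) grows at least at that
   rate: this is the Lidskii-type inequality, and it gives (i) => (ii). Under
   (ii) the growth rate is exact, so the columns of M selected by i satisfy (iii)
   for every t in (0, 1), with r = 1. For (iii) => (i), the trace identities give
   the sum for A + tB with t just below 1, and
   t d_j(A + B) = d_j(tA + tB) <= d_j(A + tB) carries it over to t = 1. *)
Require Import Defs.
From mathcomp Require Import all_boot all_order all_algebra.
From mathcomp Require Import all_classical all_reals.
From mathcomp Require Import topology normedtype.
From mathcomp Require Import lra ring.

Set Implicit Arguments.
Unset Strict Implicit.
Unset Printing Implicit Defensive.

Import Order.TTheory GRing.Theory Num.Theory numFieldNormedType.Exports.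
Local Open Scope classical_set_scope.
Local Open Scope ring_scope.

(** * Quadratic forms and symplectic matrices *)

Definition qform (R : realType) (m : nat) (A : 'M[R]_m) (x : 'cV[R]_m) : R :=
  (x^T *m A *m x) ord0 ord0.

Definition dsum (R : realType) (n : nat) (d : 'rV[R]_n) : 'M[R]_(n + n) :=
  block_mx (diag_mx d) 0 0 (diag_mx d).

Lemma qformD (R : realType) m (A B : 'M[R]_m) x :
  qform (A + B) x = qform A x + qform B x.
Proof. by rewrite /qform mulmxDr mulmxDl mxE. Qed.

Lemma qformZ (R : realType) m a (A : 'M[R]_m) x :
  qform (a *: A) x = a * qform A x.
Proof. by rewrite /qform -scalemxAr -scalemxAl mxE. Qed.

Lemma qformB (R : realType) m (A B : 'M[R]_m) x :
  qform (A - B) x = qform A x - qform B x.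
Proof. by rewrite qformD -scaleN1r qformZ mulN1r. Qed.

Lemma qform_congr (R : realType) m p (A : 'M[R]_m) (M : 'M[R]_(m, p)) x :
  qform (M^T *m A *m M) x = qform A (M *m x).
Proof. by rewrite /qform trmx_mul !mulmxA. Qed.

Lemma qform1 (R : realType) m (x : 'cV[R]_m) :
  qform 1%:M x = \sum_l x l ord0 ^+ 2.
Proof.
by rewrite /qform mulmx1 mxE; apply: eq_bigr => l _; rewrite mxE expr2.
Qed.

Lemma qform1_eq0 (R : realType) m (x : 'cV[R]_m) :
  (qform 1%:M x == 0) = (x == 0).
Proof.
rewrite qform1 psumr_eq0; last by move=> l _; rewrite sqr_ge0.
apply/allP/eqP => [h|-> l _]; last by rewrite mxE expr0n eqxx.
apply/colP => l; rewrite mxE; apply/eqP.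
by have := h l (mem_index_enum l); rewrite /= sqrf_eq0.
Qed.

Lemma qform1_ge0 (R : realType) m (x : 'cV[R]_m) : 0 <= qform 1%:M x.
Proof. by rewrite qform1 sumr_ge0 // => l _; rewrite sqr_ge0. Qed.

Lemma qform1_gt0 (R : realType) m (x : 'cV[R]_m) :
  x != 0 -> 0 < qform 1%:M x.
Proof. by move=> x0; rewrite lt_def qform1_ge0 qform1_eq0 x0. Qed.

Lemma sympJ_tr (R : realType) n : (sympJ R n)^T = - sympJ R n.
Proof.
rewrite /sympJ tr_block_mx opp_block_mx !trmx0 linearN /= trmx1.
by rewrite !opprK !oppr0.
Qed.

Lemma sympJ_sq (R : realType) n : sympJ R n *m sympJ R n = - 1%:M.
Proof.
rewrite /sympJ mulmx_block !mulmx0 !mul0mx !mul1mx mulmx1 !addr0 !add0r.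
by rewrite scalar_mx_block opp_block_mx !oppr0.
Qed.

Lemma sympJ_trl (R : realType) n : (sympJ R n)^T *m sympJ R n = 1%:M.
Proof. by rewrite sympJ_tr mulNmx sympJ_sq opprK. Qed.

Lemma sympJ_trr (R : realType) n : sympJ R n *m (sympJ R n)^T = 1%:M.
Proof. by rewrite sympJ_tr mulmxN sympJ_sq opprK. Qed.

Lemma sympJ_dsumC (R : realType) n (d : 'rV[R]_n) :
  sympJ R n *m dsum d = dsum d *m sympJ R n.
Proof.
rewrite /sympJ /dsum !mulmx_block !mulmx0 !mul0mx !mul1mx mulmx1 !addr0 !add0r.
by rewrite mulmxN mulNmx mulmx1 mul1mx.
Qed.

Lemma sympJ_dsum (R : realType) n (d : 'rV[R]_n) :
  sympJ R n *m dsum d *m (sympJ R n)^T = dsum d.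
Proof. by rewrite sympJ_dsumC -mulmxA sympJ_trr mulmx1. Qed.

Lemma sympJ_tr_dsum (R : realType) n (d : 'rV[R]_n) :
  (sympJ R n)^T *m dsum d *m sympJ R n = dsum d.
Proof. by rewrite -mulmxA -sympJ_dsumC mulmxA sympJ_trl mul1mx. Qed.

Lemma mulmx_congrZ (R : realType) m p (D : 'M[R]_m) a (Y : 'M[R]_(m, p)) :
  (a *: Y)^T *m D *m (a *: Y) = a ^+ 2 *: (Y^T *m D *m Y).
Proof. by rewrite [_^T]linearZ /= -scalemxAr -!scalemxAl scalerA. Qed.

Lemma mulmx_parallelogram (R : realType) m p (D : 'M[R]_m) (X X' : 'M[R]_(m, p)) :
  (2^-1 *: (X + X'))^T *m D *m (2^-1 *: (X + X')) +
  (2^-1 *: (X - X'))^T *m D *m (2^-1 *: (X - X')) =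
  2^-1 *: (X^T *m D *m X + X'^T *m D *m X').
Proof.
rewrite !mulmx_congrZ [(X + X')^T]linearD [(X - X')^T]linearB /=.
rewrite !(mulmxBl, mulmxBr, mulmxDl, mulmxDr, mulNmx).
move: (X^T *m D *m X) (X^T *m D *m X') (X'^T *m D *m X) (X'^T *m D *m X').
move=> a b c e.
apply/matrixP => r s; rewrite !mxE; lra.
Qed.

(* The part of [X] that intertwines the complex structures [J], so a complex
   linear map. *)
Definition complex_part (R : realType) n k (X : 'M[R]_(n + n, k + k)) :=
  2^-1 *: (X + (sympJ R n)^T *m X *m sympJ R k).

(** With X' = J^T X J, symplecticity of X reads X'^T X = 1. Hence the Gram matrix of (X + X')/2
    exceeds that of (X - X')/2 by exactly the identity. A symplectic X may shrink vectors; its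
    complex part cannot. *)
Lemma complex_part_ge1 (R : realType) n k (X : 'M[R]_(n + n, k + k)) x :
  symplecticmx X ->
  qform 1%:M x <= qform ((complex_part X)^T *m complex_part X) x.
Proof.
move=> XJ; rewrite /complex_part; set X' := _ *m _ *m _.
have e1 : X'^T *m X = 1%:M.
  by rewrite /X' !trmx_mul trmxK !mulmxA -(mulmxA _ X^T) -mulmxA XJ sympJ_trl.
have e2 : X^T *m X' = 1%:M by rewrite -[X'](trmxK) -trmx_mul e1 trmx1.
have -> : (2^-1 *: (X + X'))^T *m (2^-1 *: (X + X')) =
    1%:M + (2^-1 *: (X - X'))^T *m 1%:M *m (2^-1 *: (X - X')).
  rewrite -[in LHS](mulmx1 (_)^T) !mulmx_congrZ !mulmx1.
  rewrite [(X + X')^T]linearD [(X - X')^T]linearB /=.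
  rewrite !(mulmxBl, mulmxBr, mulmxDl, mulmxDr, mulNmx) e1 e2.
  by apply/matrixP => r s; rewrite !mxE; lra.
by rewrite qformD lerDl qform_congr qform1_ge0.
Qed.

(** Parallelogram identity for X and J^T X J, with Z the half difference; [dsum d] commutes with J.
    For d >= 0 the form pulled back by Y is thus at most the average of the form pulled back by X
    and its rotation by J. *)
Lemma complex_part_dsum (R : realType) n k (X : 'M[R]_(n + n, k + k)) d :
  let Y := complex_part X in
  exists Z : 'M[R]_(n + n, k + k), Y^T *m dsum d *m Y + Z^T *m dsum d *m Z =
  2^-1 *: (X^T *m dsum d *m X +
           (sympJ R k)^T *m (X^T *m dsum d *m X) *m sympJ R k).
Proof.
move=> Y; exists (2^-1 *: (X - (sympJ R n)^T *m X *m sympJ R k)).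
rewrite /Y /complex_part mulmx_parallelogram; congr (_ *: (_ + _)).
rewrite !trmx_mul trmxK !mulmxA -[X in (X *m _ *m _ = _)]mulmxA.
congr (_ *m _ *m _); rewrite -!mulmxA; congr (_ *m _); congr (_ *m _).
by rewrite mulmxA sympJ_dsum.
Qed.

(** The symplectic pair to which a coordinate belongs; it lets [dsum d] be read as one diagonal
    matrix of size 2n. *)
Definition halfidx (n : nat) (r : 'I_(n + n)) : 'I_n :=
  match fintype.split r with inl l => l | inr l => l end.

Lemma halfidx_lshift n (l : 'I_n) : halfidx (lshift n l) = l.
Proof. by rewrite /halfidx (unsplitK (inl _ l)). Qed.

Lemma halfidx_rshift n (l : 'I_n) : halfidx (rshift n l) = l.
Proof. by rewrite /halfidx (unsplitK (inr _ l)). Qed.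

Lemma dsumE (R : realType) n (d : 'rV[R]_n) :
  dsum d = diag_mx (\row_r d ord0 (halfidx r)).
Proof.
rewrite /dsum -diag_mx_row; congr diag_mx; apply/rowP => r.
by rewrite !mxE /halfidx; case: fintype.split.
Qed.

Lemma qform_dsum (R : realType) n (d : 'rV[R]_n) x :
  qform (dsum d) x = \sum_r d ord0 (halfidx r) * x r ord0 ^+ 2.
Proof.
rewrite dsumE /qform mul_mx_diag mxE; apply: eq_bigr => r _.
by rewrite !mxE mulrAC -expr2 mulrC.
Qed.

Lemma qform_dsum_ge0 (R : realType) n (d : 'rV[R]_n) x :
  (forall j, 0 <= d ord0 j) -> 0 <= qform (dsum d) x.
Proof.
by move=> d0; rewrite qform_dsum sumr_ge0 // => l _; rewrite mulr_ge0 // sqr_ge0.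
Qed.

(** * Monotonicity and uniqueness of symplectic eigenvalues *)

Lemma row0_kernel (R : realType) m (T : 'M[R]_m) (l : 'I_m) :
  (forall c, T l c = 0) -> exists2 x : 'cV[R]_m, x != 0 & T *m x = 0.
Proof.
move=> T0; have /det0P[v v0 vT] : \det T^T == 0.
  by rewrite det_tr (expand_det_row _ l) big1 // => c _; rewrite T0 mul0r.
by exists v^T; rewrite ?trmx_eq0 // -[T]trmxK -trmx_mul vT trmx0.
Qed.

(** A Courant-Fischer dimension count, made with the complex part Y because Y^T Y >= 1. For a
    suitable x != 0, d_j |x|^2 <= d_j |Y x|^2 <= [qform (dsum d) (Y *m x)] <= [qform (dsum e) x] <=
    e_j |x|^2. *)
Lemma symplectic_dsum_le (R : realType) n (X : 'M[R]_(n + n)) (d e : 'rV[R]_n) :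
  symplecticmx X -> (forall j, 0 <= d ord0 j) ->
  (forall j l : 'I_n, (j <= l)%N -> d ord0 j <= d ord0 l) ->
  (forall j l : 'I_n, (j <= l)%N -> e ord0 j <= e ord0 l) ->
  (forall x, qform (X^T *m dsum d *m X) x <= qform (dsum e) x) ->
  forall j, d ord0 j <= e ord0 j.
Proof.
move=> XJ d0 dle ele Xde j; pose Y : 'M_(n + n) := complex_part X.
(* The hypothesis is averaged over x and J x: [dsum e] is invariant under J, and the Z term is
   nonnegative. *)
have Yde x : qform (Y^T *m dsum d *m Y) x <= qform (dsum e) x.
  have [Z ZE] := complex_part_dsum X d.
  have := congr1 (fun M => qform M x) ZE.
  rewrite qformZ !qformD (qform_congr (dsum d) Z) (qform_congr _ (sympJ R n)) => YZ.
  have Z0 := qform_dsum_ge0 (Z *m x) d0; have h1 := Xde x.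
  have := Xde (sympJ R n *m x).
  rewrite -[X in _ <= X](qform_congr (dsum e)) sympJ_tr_dsum.
  move: YZ Z0 h1; rewrite -/Y; lra.
(* T x = 0 means that Y x vanishes on the pairs before j and x on the pairs after j. The two rows of
   pair j are zero, so a nonzero solution exists. *)
pose T := \matrix_(r, c) if (halfidx r < j)%N then Y r c else
            if (j < halfidx r)%N then (r == c)%:R else 0.
have [|x x0 Tx] := @row0_kernel _ _ T (lshift n j).
  by move=> c; rewrite mxE halfidx_lshift ltnn.
have Yx r : (halfidx r < j)%N -> (Y *m x) r ord0 = 0.
  move=> rj; have /colP/(_ r) := Tx; rewrite !mxE => Txr; rewrite -[RHS]Txr.
  by apply: eq_bigr => c _; rewrite !mxE rj.
have xr r : (j < halfidx r)%N -> x r ord0 = 0.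
  move=> rj; have /colP/(_ r) := Tx; rewrite !mxE => Txr; rewrite -[RHS]Txr.
  rewrite (bigD1 r) //= !mxE rj eqxx ltnNge ltnW //= mul1r big1 ?addr0 // => c cr.
  by rewrite !mxE rj ltnNge ltnW //= eq_sym (negPf cr) mul0r.
have := qform1_gt0 x0; set N := qform 1%:M x => N0.
rewrite -(ler_pM2r N0).
apply: (@le_trans _ _ (d ord0 j * qform 1%:M (Y *m x))).
  by rewrite ler_wpM2l // -qform_congr mulmx1 complex_part_ge1.
apply: (@le_trans _ _ (qform (dsum d) (Y *m x))).
  rewrite qform1 qform_dsum mulr_sumr ler_sum // => r _.
  have [rj|rj] := ltnP (halfidx r) j; first by rewrite Yx // expr0n !mulr0.
  by rewrite ler_wpM2r ?sqr_ge0 // dle.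
rewrite -qform_congr; apply: le_trans (Yde x) _.
rewrite /N qform1 qform_dsum mulr_sumr ler_sum // => r _.
have [rj|rj] := ltnP j (halfidx r); first by rewrite xr // expr0n !mulr0.
by rewrite ler_wpM2r ?sqr_ge0 // ele.
Qed.

Lemma symplectic_inv (R : realType) n (M : 'M[R]_(n + n)) :
  symplecticmx M -> (sympJ R n)^T *m M^T *m sympJ R n *m M = 1%:M.
Proof. by move=> MJ; rewrite -!mulmxA (mulmxA M^T) MJ sympJ_trl. Qed.

Lemma symplectic_invr (R : realType) n (M : 'M[R]_(n + n)) :
  symplecticmx M -> M *m ((sympJ R n)^T *m M^T *m sympJ R n) = 1%:M.
Proof. by move=> MJ; apply: mulmx1C; apply: symplectic_inv. Qed.

Lemma symplectic_invP (R : realType) n (M : 'M[R]_(n + n)) :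
  symplecticmx M -> symplecticmx ((sympJ R n)^T *m M^T *m sympJ R n).
Proof.
move=> MJ; have := symplectic_invr MJ; move: (_ *m sympJ R n) => N MN.
rewrite /symplecticmx /= -{1}MJ !mulmxA -trmx_mul MN trmx1 mul1mx.
by rewrite -mulmxA MN mulmx1.
Qed.

Lemma symplectic_mul (R : realType) n k p (M : 'M[R]_(n + n, k + k))
    (N : 'M[R]_(k + k, p + p)) :
  symplecticmx M -> symplecticmx N -> symplecticmx (M *m N).
Proof.
rewrite /symplecticmx /= => MJ NJ.
by rewrite trmx_mul !mulmxA -2!(mulmxA N^T) MJ NJ.
Qed.

(** Here X = M^-1 N: in a Williamson basis of A, every congruence of A becomes one of [dsum d]. *)
Lemma williamson_congrE (R : realType) n k (A : 'M[R]_(n + n)) d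
    (M : 'M[R]_(n + n)) (N : 'M[R]_(n + n, k + k)) :
  symplecticmx M -> M^T *m A *m M = dsum d ->
  exists X : 'M[R]_(n + n, k + k),
    [/\ (symplecticmx N -> symplecticmx X), N = M *m X &
    N^T *m A *m N = X^T *m dsum d *m X].
Proof.
move=> MJ MA; have MK := symplectic_invr MJ.
have KJ := symplectic_invP MJ; move: (_ *m sympJ R n) KJ MK => K KJ MK.
exists (K *m N); split.
- exact: symplectic_mul.
- by rewrite mulmxA MK mul1mx.
- rewrite -MA trmx_mul !mulmxA -(mulmxA N^T K^T) -trmx_mul MK trmx1 mulmx1.
  by rewrite -(mulmxA _ M K) MK mulmx1.
Qed.

Lemma williamson_le (R : realType) n (A B : 'M[R]_(n + n)) d e :
  (forall x, qform A x <= qform B x) ->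
  williamson_diag A d -> williamson_diag B e ->
  forall j, d ord0 j <= e ord0 j.
Proof.
move=> AB [d0 dle [M MJ MA]] [e0 ele [N NJ NB]].
have [X [/(_ NJ) XJ NX XE]] := williamson_congrE N MJ MA.
apply: (symplectic_dsum_le XJ) => // [j|x]; first exact: ltW.
by rewrite -XE -[dsum e]NB !qform_congr.
Qed.

Lemma williamson_uniq (R : realType) n (A : 'M[R]_(n + n)) d e :
  williamson_diag A d -> williamson_diag A e -> d = e.
Proof.
move=> Ad Ae; apply/rowP => j; apply/eqP.
by rewrite eq_le !(williamson_le (fun x => lexx (qform A x))).
Qed.

(** * The symplectic Ky Fan inequality *)

Lemma sum_halfidx (R : realType) n (F : 'I_n -> R) :
  \sum_r F (halfidx r) = 2 * \sum_l F l.
Proof.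
rewrite big_split_ord /= mulr_natl mulr2n; congr (_ + _); apply: eq_bigr => l _.
  by rewrite halfidx_lshift.
by rewrite halfidx_rshift.
Qed.

Lemma trace_dsum (R : realType) n p (d : 'rV[R]_n) (Z : 'M[R]_(n + n, p)) :
  \tr (Z^T *m dsum d *m Z) =
  \sum_r d ord0 (halfidx r) * (Z *m Z^T) r r.
Proof.
rewrite -mulmxA mxtrace_mulC -mulmxA dsumE; apply: eq_bigr => r _.
by rewrite mul_diag_mx !mxE.
Qed.

Lemma gram_diag_ge0 (R : realType) m p (Z : 'M[R]_(m, p)) r :
  0 <= (Z *m Z^T) r r.
Proof. by rewrite mxE sumr_ge0 // => c _; rewrite mxE -expr2 sqr_ge0. Qed.

(* [0 <= |G y - y|^2 + (y^T G y - |y|^2) = |G y|^2 - y^T G y] *)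
Lemma qform_le_sqr (R : realType) m (G : 'M[R]_m) (y : 'cV[R]_m) :
  G^T = G -> qform 1%:M y <= qform G y -> qform G y <= qform 1%:M (G *m y).
Proof.
move=> Gtr h2; have h1 := qform1_ge0 (G *m y - y).
have : qform 1%:M (G *m y - y) =
    qform 1%:M (G *m y) - 2 * qform G y + qform 1%:M y.
  rewrite {1 2 4}/qform !mulmx1 [(_ - _)^T]linearB /= mulmxBl !mulmxBr.
  rewrite trmx_mul Gtr !mulmxA /qform.
  move: (y^T *m G *m G *m y) (y^T *m G *m y) (y^T *m y) => a b c.
  rewrite !mxE; ring.
by move: h1 h2; lra.
Qed.

(** The weights are the diagonal of P = Y (Y^T Y)^-1 Y^T, the orthogonal projection onto the column
    space of Y, whose trace is p. Since Y^T Y >= 1, P lies below Y Y^T. *)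
Lemma projection_weights (R : realType) m p (Y : 'M[R]_(m, p)) :
  (forall x, qform 1%:M x <= qform (Y^T *m Y) x) ->
  exists2 c : 'I_m -> R,
    forall r, [/\ 0 <= c r, c r <= 1 & c r <= (Y *m Y^T) r r] &
    \sum_r c r = p%:R.
Proof.
move=> Y1; pose G := Y^T *m Y.
have Gtr : G^T = G by rewrite /G trmx_mul trmxK.
have Gu : G \in unitmx.
  rewrite unitmxE unitfE; apply/negP => /det0P[v v0 vG].
  have v1 : v^T != 0 by rewrite trmx_eq0.
  have := Y1 v^T; rewrite leNgt => /negP; apply.
  rewrite {1}/qform -/G trmxK vG mul0mx mxE.
  exact: qform1_gt0.
pose P := Y *m invmx G *m Y^T.
have Ptr : P^T = P by rewrite /P !trmx_mul trmxK trmx_inv Gtr mulmxA.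
have PP : P *m P^T = P.
  by rewrite Ptr /P -!mulmxA (mulmxA Y^T) -/G mulKVmx.
exists (fun r => P r r) => [r|]; last first.
  by rewrite -/(\tr P) /P -mulmxA mxtrace_mulC -mulmxA mulVmx // mxtrace1.
have P0 : 0 <= P r r by rewrite -PP gram_diag_ge0.
(* P is a symmetric idempotent, so P_rr is the sum of the squares of row r. *)
have Psq : P r r ^+ 2 <= P r r.
  have {2}-> : P r r = \sum_c P r c ^+ 2.
    by rewrite -[in LHS]PP mxE; apply: eq_bigr => c _; rewrite [_^T _ _]mxE expr2.
  by rewrite (bigD1 r) //= lerDl sumr_ge0 // => c _; rewrite sqr_ge0.
have P1 : P r r <= 1.
  rewrite leNgt; apply/negP => P1; move: Psq.
  by rewrite expr2 ger_pMr ?(lt_trans ltr01) // leNgt P1.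
split=> //.
(* With G y = e, the entries P_rr and (Y Y^T)_rr become y^T G y and |G y|^2. *)
pose e := col r Y^T; pose y := invmx G *m e.
have Gy : G *m y = e by rewrite /y mulKVmx.
have -> : P r r = qform G y.
  rewrite /qform -mulmxA Gy /y trmx_mul trmx_inv Gtr /e /P.
  by rewrite tr_col trmxK -row_mul !mxE; apply: eq_bigr => s _; rewrite !mxE.
have -> : (Y *m Y^T) r r = qform 1%:M (G *m y).
  by rewrite Gy qform1 mxE; apply: eq_bigr => c _; rewrite !mxE expr2.
exact: qform_le_sqr.
Qed.

(** Rotating by J leaves the trace unchanged, so X may be replaced by its complex part. The trace is
    then at least a sum of the d_j with weights in [0, 1] of total 2k, which is smallest when the
    weight sits on the k lowest pairs. *)
Lemma kyfan_dsum (R : realType) n k (X : 'M[R]_(n + n, k + k)) (d : 'rV[R]_n) :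
  (0 < k)%N -> symplecticmx X -> (forall j, 0 <= d ord0 j) ->
  (forall j l : 'I_n, (j <= l)%N -> d ord0 j <= d ord0 l) ->
  2 * \sum_(j < n | (j < k)%N) d ord0 j <= \tr (X^T *m dsum d *m X).
Proof.
move=> k0 XJ d0 dle; pose Y : 'M_(n + n, k + k) := complex_part X.
have [|c c01 cE] := @projection_weights _ _ _ Y.
  by move=> x; exact: complex_part_ge1.
(* Weights at most 1 with total 2k need at least 2k coordinates. *)
have kn : (k <= n)%N.
  have : (k + k)%:R <= (n + n)%:R :> R.
    rewrite -cE -[X in _ <= X%:R]card_ord -sumr_const ler_sum // => r _.
    by have [] := c01 r.
  by rewrite ler_nat !addnn leq_double.
have j0P : (k.-1 < n)%N by rewrite prednK.
(* The k-th smallest entry, at index k - 1 because indices start at 0. It serves as threshold. *)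
pose t := d ord0 (Ordinal j0P).
have -> : \tr (X^T *m dsum d *m X) =
    2^-1 * \tr (X^T *m dsum d *m X +
     (sympJ R k)^T *m (X^T *m dsum d *m X) *m sympJ R k).
  rewrite mxtraceD -(mulmxA _ _ (sympJ R k)) (mxtrace_mulC (sympJ R k)^T).
  by rewrite -[(_ *m sympJ R k) *m _]mulmxA sympJ_trr mulmx1; lra.
have [Z ZE] := complex_part_dsum X d.
rewrite -mxtraceZ -ZE mxtraceD -/Y.
have Z0 : 0 <= \tr (Z^T *m dsum d *m Z).
  by rewrite trace_dsum sumr_ge0 // => r _; rewrite mulr_ge0 // gram_diag_ge0.
apply: le_trans (_ : \tr (Y^T *m dsum d *m Y) <= _); last by rewrite lerDl.
rewrite trace_dsum.
apply: (@le_trans _ _ (\sum_r d ord0 (halfidx r) * c r)); last first.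
  by apply: ler_sum => r _; have [_ _ cr] := c01 r; rewrite ler_wpM2l.
have -> : \sum_r d ord0 (halfidx r) * c r =
    \sum_r (d ord0 (halfidx r) - t) * c r + t * (k + k)%:R.
  by rewrite -cE mulr_sumr -big_split; apply: eq_bigr => r _ /=; ring.
(* Below the threshold the difference is nonpositive and c <= 1 is used; above it the difference is
   nonnegative and c >= 0 is used. *)
have h r : (if (halfidx r < k)%N then d ord0 (halfidx r) - t else 0) <=
    (d ord0 (halfidx r) - t) * c r.
  have [c0 c1 _] := c01 r; case: ltnP => hr.
    have : d ord0 (halfidx r) <= t by apply: dle; rewrite -ltnS prednK.
    by rewrite -subr_le0 => dt; rewrite ler_niMr.
  by rewrite mulr_ge0 // subr_ge0 dle //= (leq_trans _ hr) // leq_pred.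
apply: le_trans (lerD (ler_sum (index_enum _) (fun r _ => h r)) (lexx _)).
rewrite (sum_halfidx (fun l => if (l < k)%N then d ord0 l - t else 0)).
rewrite -big_mkcond /= sumrB -(big_ord_widen n (fun=> t) kn).
rewrite sumr_const card_ord natrD -mulr_natl; lra.
Qed.

Lemma williamson_kyfan (R : realType) n k (B : 'M[R]_(n + n)) d
    (N : 'M[R]_(n + n, k + k)) :
  (0 < k)%N -> symplecticmx N -> williamson_diag B d ->
  2 * \sum_(j < n | (j < k)%N) d ord0 j <= \tr (N^T *m B *m N).
Proof.
move=> k0 NJ [d0 dle [M MJ MB]].
have [X [/(_ NJ) XJ _ ->]] := williamson_congrE N MJ MB.
by apply: kyfan_dsum => // j; exact: ltW.
Qed.

(** * Entrywise limits of matrices *)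

(** The parameter space is arbitrary: it is the space of vectors itself for Rayleigh quotients, and
    the real parameter s for perturbations. *)
Definition mxcvg (R : realType) (T : Type) (F : set_system T) m n
    (X : T -> 'M[R]_(m, n)) (L : 'M[R]_(m, n)) : Prop :=
  forall i j, X s i j @[s --> F] --> L i j.

Lemma mxcvg_cst (R : realType) T (F : set_system T) {FF : Filter F} m n
    (L : 'M[R]_(m, n)) : mxcvg F (fun=> L) L.
Proof. by move=> i j; exact: cvg_cst. Qed.

Lemma mxcvg_tr (R : realType) T (F : set_system T) m n
    (X : T -> 'M[R]_(m, n)) L :
  mxcvg F X L -> mxcvg F (fun s => (X s)^T) L^T.
Proof. move=> XL i j; rewrite mxE (_ : (fun s => _) = (fun s => X s j i)) //.
by apply/funext => s; rewrite mxE. Qed.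

Lemma mxcvg_mul (R : realType) T (F : set_system T) {FF : Filter F} m n p
    (X : T -> 'M[R]_(m, n)) (Y : T -> 'M[R]_(n, p)) L K :
  mxcvg F X L -> mxcvg F Y K -> mxcvg F (fun s => X s *m Y s) (L *m K).
Proof.
move=> XL YK i j.
rewrite mxE (_ : (fun s => _) = (fun s => \sum_l X s i l * Y s l j)); last first.
  by apply/funext => s; rewrite mxE.
apply: cvg_big => [|l _]; first exact: add_continuous.
exact: cvgM.
Qed.

Lemma real_cvg_uniq (R : realType) T (F : set_system T) {FF : ProperFilter F}
    (f : T -> R) (a b : R) :
  f s @[s --> F] --> a -> f s @[s --> F] --> b -> a = b.
Proof. by move=> fa fb; exact: norm_cvg_unique fa fb. Qed.

Lemma mxcvg_uniq (R : realType) T (F : set_system T) {FF : ProperFilter F} m n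
    (X : T -> 'M[R]_(m, n)) L K :
  mxcvg F X L -> mxcvg F X K -> L = K.
Proof.
by move=> XL XK; apply/matrixP => i j; exact: real_cvg_uniq (XL i j) (XK i j).
Qed.

Lemma cvg_near_eq (R : realType) T (F : set_system T) {FF : Filter F}
    (f g : T -> R) (l : R) :
  (\forall s \near F, f s = g s) ->
  f s @[s --> F] --> l -> g s @[s --> F] --> l.
Proof. by move=> fg; apply: cvg_trans; exact: near_eq_cvg. Qed.

(** Ultrafilters replace the extraction of subsequences. Compactness of [-K, K] gives a cluster
    point, and an ultrafilter converges to its cluster points because it contains each set or its
    complement. *)
Lemma ultra_bounded_cvg (R : realType) T (F : set_system T)
    {FU : UltraFilter F} (f : T -> R) (K : R) :
  (\forall s \near F, `|f s| <= K) -> exists l : R, f s @[s --> F] --> l.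
Proof.
move=> fK; have [|l [_ cl]] := @segment_compact R (- K) K (f @ F) _.
  by near=> s; rewrite /= in_itv /= -ler_norml; near: s.
exists l => A Al; have [//|FA] := in_ultra_setVsetC (f @^-1` A) FU.
by have [x []] := cl (~` A) A FA Al.
Unshelve. all: by end_near. Qed.

Lemma ultra_bounded_mxcvg (R : realType) T (F : set_system T)
    {FU : UltraFilter F} m n (X : T -> 'M[R]_(m, n)) (K : R) :
  (forall i j, \forall s \near F, `|X s i j| <= K) -> exists L, mxcvg F X L.
Proof.
move=> XK; have XL i j : exists l : R, X s i j @[s --> F] --> l.
  exact: ultra_bounded_cvg (XK i j).
exists (\matrix_(i, j) sval (cid (XL i j))) => i j.
by rewrite mxE; case: cid.
Qed.

Lemma mxcvg_qform (R : realType) T (F : set_system T) {FF : Filter F} m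
    (A : 'M[R]_m) (X : T -> 'cV[R]_m) L :
  mxcvg F X L -> qform A (X s) @[s --> F] --> qform A L.
Proof.
move=> XL; apply: (mxcvg_mul (X := fun s => (X s)^T *m A)) => //.
by apply: mxcvg_mul; [exact: mxcvg_tr|exact: mxcvg_cst].
Qed.

(** * Extremal Rayleigh quotients *)

Lemma qform_scale (R : realType) m (A : 'M[R]_m) a x :
  qform A (a *: x) = a ^+ 2 * qform A x.
Proof. by rewrite /qform mulmx_congrZ mxE. Qed.

Lemma qform0 (R : realType) m (A : 'M[R]_m) : qform A 0 = 0.
Proof. by rewrite /qform mulmx0 mxE. Qed.

Lemma qform_normalize (R : realType) m (x : 'cV[R]_m) : x != 0 ->
  exists2 a, 0 < a & qform 1%:M (a *: x) = 1.
Proof.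
move=> x0; have N0 := qform1_gt0 x0; exists (Num.sqrt (qform 1%:M x))^-1.
  by rewrite invr_gt0 sqrtr_gt0.
by rewrite qform_scale exprVn sqr_sqrtr ?ltW // mulVf // gt_eqF.
Qed.

(** An ultrafilter refining the superlevel sets of the quotient on the unit sphere of the kernel
    converges, and its limit is a maximiser. No prior upper bound on the quotient is needed. The
    inequality is cross-multiplied so that it also covers x = 0. *)
Lemma rayleigh_max (R : realType) m p (P G : 'M[R]_m) (T : 'M[R]_(p, m)) :
  (forall x, x != 0 -> 0 < qform P x) ->
  (exists2 x : 'cV[R]_m, x != 0 & T *m x = 0) ->
  exists z : 'cV[R]_m, [/\ z != 0, T *m z = 0 &
    forall x, T *m x = 0 -> qform G x * qform P z <= qform G z * qform P x].
Proof.
move=> P0 [x0 x00 Tx0].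
pose S := [set x : 'cV[R]_m | T *m x = 0 /\ qform 1%:M x = 1].
have S0 x : S x -> x != 0.
  by move=> [_ x1]; apply: contra_eq_neq x1 => ->; rewrite qform0 eq_sym oner_eq0.
pose rho x := qform G x / qform P x.
pose U y := [set x | S x /\ rho y <= rho x].
have Ule y y' : rho y <= rho y' -> U y' `<=` U y.
  by move=> yy' x [Sx y'x]; split=> //; exact: le_trans y'x.
have [y0 Sy0] : exists y, S y.
  have [a a0 ax1] := qform_normalize x00; exists (a *: x0); split=> //.
  by rewrite -scalemxAr Tx0 scaler0.
(* Superlevel sets are nested, hence form a filter base. *)
have UF : ProperFilter (filter_from S U).
  apply: filter_from_proper => [|y Sy]; last by exists y.
  apply: filter_from_filter => [|y y' Sy Sy'].
    by exists y0.
  by have [yy'|/ltW yy'] := leP (rho y) (rho y'); [exists y'|exists y] => //;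
    rewrite subsetI; split=> //; exact: Ule.
have [F [FU UsubF]] := ultraFilterLemma UF.
have FUy y : S y -> F (U y) by move=> Sy; apply: UsubF; exists y.
have FS : F S by apply: filterS (FUy _ Sy0) => x [].
have [z Xz] : exists z, mxcvg F id z.
  apply: (@ultra_bounded_mxcvg _ _ _ _ _ _ _ 1) => i j.
  apply: filterS FS => x [_ x1]; rewrite ord1.
  rewrite -[leRHS]sqrtr1 -sqrtr_sqr ler_wsqrtr // -x1 qform1.
  by rewrite (bigD1 i) //= lerDl sumr_ge0 // => l _; rewrite sqr_ge0.
have Tz : T *m z = 0.
  have TXz : mxcvg F (fun x => T *m x) (T *m z).
    by apply: mxcvg_mul Xz; exact: mxcvg_cst.
  apply: (mxcvg_uniq TXz) => i j.
  apply: cvg_near_eq (cvg_cst _); apply: filterS FS => x [-> _].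
  by [].
have qz A : qform A x @[x --> F] --> qform A z by exact: mxcvg_qform.
have z1 : qform 1%:M z = 1.
  apply: (real_cvg_uniq (qz 1%:M)).
  by apply: cvg_near_eq (cvg_cst _); apply: filterS FS => x [_ ->].
have Sz : S z by [].
exists z; split=> //; first exact: S0.
move=> x Tx; have [->|xn0] := eqVneq x 0; first by rewrite !qform0 !(mul0r, mulr0).
have [a a0 ax1] := qform_normalize xn0.
have Sax : S (a *: x) by split; rewrite // -scalemxAr Tx scaler0.
(* For the normalised x this holds at every y in [U (a *: x)], a member of F, and so it passes to
   the limit z. *)
have : qform G (a *: x) * qform P z <= qform G z * qform P (a *: x).
  apply: (ler_cvg_to (cvgM (cvg_cst _) (qz P))
    (cvgM (qz G) (cvg_cst _))).
  apply: filterS (FUy _ Sax) => y [Sy].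
  rewrite /rho ler_pdivrMr ?P0 ?S0 // mulrAC ler_pdivlMr ?P0 ?S0 //.
rewrite !qform_scale -mulrA [leRHS]mulrCA ler_pM2l // exprn_gt0 //.
Qed.

(** Maximising |x|^2 / [qform A x] without constraint minimises the inverse quotient, whose minimum
    is c. In dimension 0 there is no nonzero vector and any c serves. *)
Lemma posdef_coercive (R : realType) m (A : 'M[R]_m) :
  posdefmx A -> exists2 c, 0 < c & forall x, c * qform 1%:M x <= qform A x.
Proof.
move=> [_ A0]; have [[x0 x00]|nx] := pselect (exists x : 'cV[R]_m, x != 0).
  have [//||z [z0 _ zA]] := @rayleigh_max _ _ 1 A 1%:M 0.
    by exists x0; rewrite ?mul0mx.
  have N0 := qform1_gt0 z0; exists (qform A z / qform 1%:M z).
    by rewrite divr_gt0 //; exact: A0.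
  move=> x; rewrite mulrAC ler_pdivrMr // mulrC [leRHS]mulrC.
  by apply: zA; rewrite mul0mx.
exists 1 => // x; have [->|x0] := eqVneq x 0; first by rewrite !qform0 mulr0.
by case: nx; exists x.
Qed.

(** * Williamson's theorem *)

Definition bform (R : realType) (m p : nat) (A : 'M[R]_(m, p))
    (x : 'cV[R]_m) (y : 'cV[R]_p) : R := (x^T *m A *m y) ord0 ord0.

Lemma qformE (R : realType) m (A : 'M[R]_m) x : qform A x = bform A x x.
Proof. by []. Qed.

Lemma bform_tr (R : realType) m p (A : 'M[R]_(m, p)) x y :
  bform A x y = bform A^T y x.
Proof.
by rewrite /bform -[in LHS](trmxK (_ *m _ *m _)) mxE !trmx_mul trmxK mulmxA.
Qed.

Lemma bform_mulr (R : realType) m p q (A : 'M[R]_(m, p)) (B : 'M[R]_(p, q)) x y :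
  bform A x (B *m y) = bform (A *m B) x y.
Proof. by rewrite /bform !mulmxA. Qed.

Lemma bform_mull (R : realType) m p q (A : 'M[R]_(m, p)) (B : 'M[R]_(m, q)) x y :
  bform A (B *m x) y = bform (B^T *m A) x y.
Proof. by rewrite /bform trmx_mul !mulmxA. Qed.

Lemma bformDl (R : realType) m p (A : 'M[R]_(m, p)) x x' y :
  bform A (x + x') y = bform A x y + bform A x' y.
Proof. by rewrite /bform [(_ + _)^T]linearD /= !mulmxDl mxE. Qed.

Lemma bformDr (R : realType) m p (A : 'M[R]_(m, p)) x y y' :
  bform A x (y + y') = bform A x y + bform A x y'.
Proof. by rewrite /bform mulmxDr mxE. Qed.

Lemma bformZl (R : realType) m p (A : 'M[R]_(m, p)) a x y :
  bform A (a *: x) y = a * bform A x y.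
Proof. by rewrite /bform [(_ *: _)^T]linearZ /= -!scalemxAl mxE. Qed.

Lemma bformZr (R : realType) m p (A : 'M[R]_(m, p)) a x y :
  bform A x (a *: y) = a * bform A x y.
Proof. by rewrite /bform -scalemxAr mxE. Qed.

Lemma bformZ (R : realType) m p a (A : 'M[R]_(m, p)) x y :
  bform (a *: A) x y = a * bform A x y.
Proof. by rewrite /bform -scalemxAr -scalemxAl mxE. Qed.

Lemma bformN (R : realType) m p (A : 'M[R]_(m, p)) x y :
  bform (- A) x y = - bform A x y.
Proof. by rewrite -scaleN1r bformZ mulN1r. Qed.

Lemma bformJC (R : realType) n (x y : 'cV[R]_(n + n)) :
  bform (sympJ R n) y x = - bform (sympJ R n) x y.
Proof. by rewrite bform_tr sympJ_tr bformN. Qed.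

Lemma bformJ_self (R : realType) n (x : 'cV[R]_(n + n)) :
  bform (sympJ R n) x x = 0.
Proof. by have := bformJC x x; lra. Qed.

Lemma posdef_unit (R : realType) m (A : 'M[R]_m) : posdefmx A -> A \in unitmx.
Proof.
move=> [_ A0]; rewrite unitmxE unitfE; apply/negP => /det0P[v v0 vA].
have /A0 : v^T != 0 by rewrite trmx_eq0.
by rewrite trmxK vA mul0mx mxE ltxx.
Qed.

(** First-order condition at a minimum. The test value t = -a / (b^2 + 1) works for either sign of b
    because b < b^2 + 1. *)
Lemma linear_coeff_eq0 (R : realType) (a b : R) :
  (forall t, 0 <= a * t + b * t ^+ 2) -> a = 0.
Proof.
move=> h; apply/eqP; apply/negPn/negP => a0.
have b0 : 0 < b ^+ 2 + 1 by rewrite ltr_wpDl ?sqr_ge0.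
have := h (- a / (b ^+ 2 + 1)); apply/negP; rewrite -ltNge.
have -> : a * (- a / (b ^+ 2 + 1)) + b * (- a / (b ^+ 2 + 1)) ^+ 2 =
    a ^+ 2 / (b ^+ 2 + 1) ^+ 2 * (b - (b ^+ 2 + 1)).
  by field; rewrite gt_eqF.
have a2 : 0 < a ^+ 2 / (b ^+ 2 + 1) ^+ 2.
  by apply: divr_gt0; [rewrite exprn_even_gt0|rewrite exprn_gt0].
rewrite (pmulr_rlt0 _ a2); have := sqr_ge0 (2 * b - 1); nra.
Qed.

Lemma mulmx_bformE (R : realType) m p m' p' (B : 'M[R]_(m, p))
    (X : 'M[R]_(m, m')) (Y : 'M[R]_(p, p')) r s :
  (X^T *m B *m Y) r s = bform B (col r X) (col s Y).
Proof.
by rewrite /bform tr_col -row_mul !mxE; apply: eq_bigr => c _; rewrite !mxE.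
Qed.

Section Williamson.
Variables (R : realType) (n : nat) (A : 'M[R]_(n + n)).
Hypothesis hA : posdefmx A.
Let J := sympJ R n.
Let w := bform J.

Definition symp_orth (m : nat) (u v : nat -> 'cV[R]_(n + n)) x :=
  forall l, (l < m)%N -> w (u l) x = 0 /\ w (v l) x = 0.

(* The last clause says that no pair in the symplectic complement of the pairs
   found so far has a Rayleigh quotient below [d l]; it is what makes the greedy
   choice produce a nondecreasing [d]. *)
Definition partial_williamson (m : nat) (u v : nat -> 'cV[R]_(n + n))
    (d : nat -> R) : Prop :=
  [/\ forall l, (l < m)%N -> [/\ 0 < d l, A *m u l = d l *: (J *m v l) &
                               A *m v l = - d l *: (J *m u l)],
      forall l l', (l < m)%N -> (l' < m)%N ->
        [/\ w (u l) (v l') = (l == l')%:R, w (u l) (u l') = 0 &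
            w (v l) (v l') = 0],
      forall l l', (l <= l')%N -> (l' < m)%N -> d l <= d l' &
      forall l x y, (l < m)%N -> symp_orth m u v x -> symp_orth m u v y ->
        2 * d l * w x y <= qform A x + qform A y].

(** A u and A v are nonzero multiples of J v and J u, so w(u, A^-1 r) is a multiple of v^T r and
    w(v, A^-1 r) one of u^T r. This makes A^-1 r an admissible test direction. *)
Lemma symp_orth_inv m u v d r :
  partial_williamson m u v d ->
  (forall l, (l < m)%N -> bform 1%:M (u l) r = 0 /\ bform 1%:M (v l) r = 0) ->
  symp_orth m u v (invmx A *m r).
Proof.
move=> [eig _ _ _] ur l lm; have [d0 Au Av] := eig l lm.
have [ur0 vr0] := ur l lm; have Au' := posdef_unit hA.
have Atr : A^T = A by case: hA.
have key x : bform A x (invmx A *m r) = bform 1%:M x r.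
  by rewrite bform_mulr mulmxV.
split.
- have : bform 1%:M (A *m v l) (invmx A *m r) = 0.
    by rewrite bform_mull Atr mulmx1 key.
  rewrite Av bformZl bform_mull sympJ_tr mulmx1 bformN -/w => /eqP.
  by rewrite mulNr mulrN opprK mulf_eq0 gt_eqF //= => /eqP.
- have : bform 1%:M (A *m u l) (invmx A *m r) = 0.
    by rewrite bform_mull Atr mulmx1 key.
  rewrite Au bformZl bform_mull sympJ_tr mulmx1 bformN -/w => /eqP.
  by rewrite mulrN oppr_eq0 mulf_eq0 gt_eqF //= => /eqP.
Qed.

Lemma symp_orth_A m u v d x :
  partial_williamson m u v d -> symp_orth m u v x ->
  forall l, (l < m)%N -> bform A (u l) x = 0 /\ bform A (v l) x = 0.
Proof.
move=> [eig _ _ _] ox l lm; have [d0 Au Av] := eig l lm.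
have [ux vx] := ox l lm; have Atr : A^T = A by case: hA.
have key y : bform A y x = bform 1%:M (A *m y) x by rewrite bform_mull mulmx1 Atr.
rewrite !key Au Av !bformZl !bform_mull !sympJ_tr mulmx1 !bformN -/w ux vx.
by rewrite !oppr0 !mulr0.
Qed.

(** The 2m conditions are padded with zero rows to a square matrix, which is singular since m <
    n. *)
Lemma symp_orth_mx m u v :
  (m < n)%N -> exists T : 'M[R]_(n + n),
    (exists2 x : 'cV[R]_(n + n), x != 0 & T *m x = 0) /\
    forall x, T *m x = 0 <-> symp_orth m u v x.
Proof.
move=> mn.
pose T : 'M_(n + n) := \matrix_(r, c) match fintype.split r with
  | inl l => if (l < m)%N then ((u l)^T *m J) ord0 c else 0
  | inr l => if (l < m)%N then ((v l)^T *m J) ord0 c else 0 end.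
have Tl (x : 'cV_(n + n)) (l : 'I_n) : (T *m x) (lshift n l) ord0 =
    if (l < m)%N then w (u l) x else 0.
  rewrite mxE; under eq_bigr do rewrite mxE (unsplitK (inl _ l)).
  case: ifP => // lm; last by rewrite big1 // => c _; rewrite mul0r.
  by rewrite /w /bform [RHS]mxE.
have Tr (x : 'cV_(n + n)) (l : 'I_n) : (T *m x) (rshift n l) ord0 =
    if (l < m)%N then w (v l) x else 0.
  rewrite mxE; under eq_bigr do rewrite mxE (unsplitK (inr _ l)).
  case: ifP => // lm; last by rewrite big1 // => c _; rewrite mul0r.
  by rewrite /w /bform [RHS]mxE.
exists T; split.
  apply: (@row0_kernel _ _ _ (lshift n (Ordinal mn))) => c.
  by rewrite mxE (unsplitK (inl _ (Ordinal mn))) /= ltnn.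
move=> x; split => [Tx l lm|ox].
  pose l' := Ordinal (ltn_trans lm mn).
  have := Tl x l'; have := Tr x l'; rewrite Tx !mxE /= lm => <- <-.
  by [].
apply/colP => r; rewrite [RHS]mxE -[r]splitK; case: (fintype.split r) => l /=.
  by rewrite Tl; case: ifP => // /ox[].
by rewrite Tr; case: ifP => // /ox[].
Qed.

(** The next pair maximises 2 w(x, y) / ([qform A x] + [qform A y]) on the symplectic complement;
    the new eigenvalue is the inverse of the maximum. *)
Lemma partial_williamson_step m u v d :
  (m < n)%N -> partial_williamson m u v d ->
  exists u' v' d', partial_williamson m.+1 u' v' d'.
Proof.
move=> mn pw; have [eig sympl dle dmax] := pw.
have Atr : A^T = A by case: hA.
have A0 : forall x, x != 0 -> 0 < qform A x by case: hA.
have A0' x : 0 <= qform A x.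
  by have [->|/A0/ltW//] := eqVneq x 0; rewrite qform0.
have Au := posdef_unit hA.
have [T [[x0 x00 Tx0] TP]] := symp_orth_mx u v mn.
(* A pair (x, y) is stacked into one vector: P and G give the denominator and numerator of the
   quotient, T2 the orthogonality constraints. *)
pose P := block_mx A 0 0 A.
pose G := block_mx 0 J J^T 0.
pose T2 := block_mx T 0 0 T.
have PE x y : qform P (col_mx x y) = qform A x + qform A y.
  rewrite /qform tr_col_mx mul_row_block !mulmx0 addr0 add0r mul_row_col.
  by rewrite mxE.
have GE x y : qform G (col_mx x y) = 2 * w x y.
  rewrite {1}/qform tr_col_mx mul_row_block !mulmx0 addr0 add0r mul_row_col.
  rewrite mxE -/(bform J^T y x) -/(bform J x y) [bform J^T y x]bform_tr trmxK.
  by rewrite -/w; lra.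
have T2E x y : T2 *m col_mx x y = 0 <-> T *m x = 0 /\ T *m y = 0.
  rewrite mul_block_col !mul0mx addr0 add0r; split=> [|[-> ->]].
    by rewrite -[0 in X in X -> _]vsubmxK => /eq_col_mx[-> ->]; rewrite !linear0.
  by rewrite col_mx0.
have [z||z [z0 T2z zmax]] := @rayleigh_max _ _ _ P G T2.
- rewrite -[z]vsubmxK PE => z0.
  have [e|/A0 u0] := eqVneq (usubmx z) 0; last by rewrite ltr_wpDr.
  have [e'|/A0 u0] := eqVneq (dsubmx z) 0; last by rewrite ltr_wpDl.
  by move: z0; rewrite e e' col_mx0 eqxx.
- by exists (col_mx x0 0); [rewrite col_mx_eq0 negb_and x00|apply/T2E; rewrite mulmx0].
move: z0 T2z zmax; rewrite -[z]vsubmxK.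
move: (usubmx z) (dsubmx z) => {z} x y z0 /T2E[/TP ox /TP oy].
rewrite PE GE => zmax.
pose N := qform A x + qform A y; pose s := w x y.
have N0 : 0 < N.
  have [x_0|/A0 u0] := eqVneq x 0; last by rewrite ltr_wpDr.
  have [y_0|/A0 u0] := eqVneq y 0; last by rewrite ltr_wpDl.
  by move: z0; rewrite x_0 y_0 col_mx0 eqxx.
have abmax a b : symp_orth m u v a -> symp_orth m u v b ->
    w a b * N <= s * (qform A a + qform A b).
  move=> /TP oa /TP ob; have /zmax : T2 *m col_mx a b = 0 by apply/T2E.
  by rewrite PE GE -/N -/s; lra.
(* For x0 in the complement, b = A^-1 J^T x0 also lies in it and w(x0, b) = [qform A b] > 0, so the
   maximum is positive. *)
have s0 : 0 < s.
  pose b := invmx A *m (J^T *m x0).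
  have /TP ox0 := Tx0.
  have ob : symp_orth m u v b.
    apply: (symp_orth_inv pw) => l lm; have [ux vx] := ox0 l lm.
    by rewrite !bform_mulr mul1mx sympJ_tr !bformN -/w ux vx oppr0.
  have wb : w x0 b = qform A b.
    by rewrite qformE {2}/b bform_mulr mulmxV // bform_tr trmx1 bform_mull mulmx1 trmxK.
  have b0 : b != 0.
    apply: contraNneq x00 => b_0; rewrite -(mul1mx x0) -(sympJ_trr R n) -mulmxA.
    by rewrite -(mulKVmx Au (J^T *m x0)) -/b b_0 !mulmx0.
  have := abmax _ _ ox0 ob; rewrite wb => h.
  have h1 : 0 < qform A b * N by rewrite mulr_gt0 // A0.
  have h2 : 0 < qform A x0 + qform A b by rewrite ltr_wpDl // A0.
  by have := lt_le_trans h1 h; rewrite pmulr_lgt0.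
have ox_lin a b t : symp_orth m u v a -> symp_orth m u v b ->
    symp_orth m u v (a + t *: b).
  move=> oa ob l lm; have [ua va] := oa l lm; have [ub vb] := ob l lm.
  by rewrite /w !bformDr !bformZr -/w ua va ub vb mulr0 addr0.
(* Stationarity at the maximum, tested against the vector that [A^-1] makes of
   the residual itself. *)
have stat a b : symp_orth m u v a -> symp_orth m u v b ->
    2 * s * (bform A x a + bform A y b) = N * (w a y + w x b).
  move=> oa ob; apply/eqP; rewrite -subr_eq0; apply/eqP.
  set c := (X in X = 0).
  apply: (@linear_coeff_eq0 _ c (s * (qform A a + qform A b) - w a b * N)) => t.
  have := abmax _ _ (ox_lin x a t ox oa) (ox_lin y b t oy ob).
  rewrite /w !qformE !(bformDl, bformDr, bformZl, bformZr) -/w.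
  rewrite (bform_tr A a) (bform_tr A b) Atr -!qformE -/s /c /N; lra.
have sol1 : (2 * s) *: (A *m x) = N *: (J *m y).
  pose r := (2 * s) *: (A *m x) - N *: (J *m y).
  have oh : symp_orth m u v (invmx A *m r).
    apply: (symp_orth_inv pw) => l lm; rewrite /r -scaleNr.
    rewrite !bformDr !bformZr !bform_mulr !mul1mx -/w.
    have [-> ->] := oy l lm; have [-> ->] := symp_orth_A pw ox lm.
    by rewrite !mulr0 addr0.
  have o0 : symp_orth m u v 0 by move=> l lm; rewrite /w /bform !mulmx0 mxE.
  have := stat _ _ oh o0; set h := _ *m r in oh *.
  have -> : bform A y 0 = 0 by rewrite /bform mulmx0 mxE.
  have -> : w x 0 = 0 by rewrite /w /bform mulmx0 mxE.
  rewrite !addr0 => e.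
  (* Since A h = r, this value is h^T r, which the stationarity equation annihilates. *)
  have : qform A h = 0.
    rewrite qformE {2}/h bform_mulr mulmxV // /r -scaleNr bformDr !bformZr.
    rewrite !bform_mulr !mul1mx (bform_tr A) Atr e -/w; ring.
  have [h0 _|/A0 h0 h1] := eqVneq h 0; last by move: h0; rewrite h1 ltxx.
  by apply/eqP; rewrite -subr_eq0 -/r -(mulKVmx Au r) -/h h0 mulmx0.
have sol2 : (2 * s) *: (A *m y) = - N *: (J *m x).
  pose r := (2 * s) *: (A *m y) + N *: (J *m x).
  have oh : symp_orth m u v (invmx A *m r).
    apply: (symp_orth_inv pw) => l lm; rewrite /r.
    rewrite !bformDr !bformZr !bform_mulr !mul1mx -/w.
    have [-> ->] := ox l lm; have [-> ->] := symp_orth_A pw oy lm.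
    by rewrite !mulr0 addr0.
  have o0 : symp_orth m u v 0 by move=> l lm; rewrite /w /bform !mulmx0 mxE.
  have := stat _ _ o0 oh; set h := _ *m r in oh *.
  have -> : bform A x 0 = 0 by rewrite /bform mulmx0 mxE.
  have -> : w 0 y = 0 by rewrite /w /bform trmx0 !mul0mx mxE.
  rewrite !add0r => e.
  have : qform A h = 0.
    rewrite qformE {2}/h bform_mulr mulmxV // /r bformDr !bformZr.
    rewrite !bform_mulr !mul1mx (bform_tr A) Atr e -/w [w h x]bformJC -/w; ring.
  have [h0 _|/A0 h0 h1] := eqVneq h 0; last by move: h0; rewrite h1 ltxx.
  by apply/eqP; rewrite scaleNr -addr_eq0 -/r -(mulKVmx Au r) -/h h0 mulmx0.
(* The scaling c makes w(um, vm) = 1; dividing 2s A x = N J y by 2s gives the eigenvalue dm. *)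
pose c := (Num.sqrt s)^-1; pose dm := N / (2 * s).
have c2 : c ^+ 2 * s = 1.
  by rewrite exprVn sqr_sqrtr ?mulVf ?gt_eqF // ltW.
have dm0 : 0 < dm by rewrite divr_gt0 // mulr_gt0.
pose um := c *: x; pose vm := c *: y.
have s2 : 2 * s != 0 by rewrite gt_eqF // mulr_gt0.
have sdm : 2 * s * dm = N by rewrite /dm mulrC divfK.
have Aum : A *m um = dm *: (J *m vm).
  apply: (scalerI s2); rewrite scalerA sdm /um /vm.
  by rewrite -!scalemxAr scalerA mulrC -scalerA sol1 !scalerA mulrC.
have Avm : A *m vm = - dm *: (J *m um).
  apply: (scalerI s2); rewrite scalerA mulrN sdm /um /vm.
  by rewrite -!scalemxAr scalerA mulrC -scalerA sol2 !scalerA mulrC.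
have wuv : w um vm = 1 by rewrite /w /um /vm bformZl bformZr -/w mulrA -expr2.
have oum : symp_orth m u v um.
  by move=> l /ox[]; rewrite /w /um !bformZr -/w => -> ->; rewrite mulr0.
have ovm : symp_orth m u v vm.
  by move=> l /oy[]; rewrite /w /vm !bformZr -/w => -> ->; rewrite mulr0.
have qum : qform A um = dm.
  by rewrite qformE -(mul1mx A) -bform_mulr Aum bformZr bform_mulr mul1mx -/w wuv mulr1.
have qvm : qform A vm = dm.
  rewrite qformE -(mul1mx A) -bform_mulr Avm bformZr bform_mulr mul1mx.
  by rewrite bformJC -/w wuv; ring.
exists (fun l => if (l < m)%N then u l else um).
exists (fun l => if (l < m)%N then v l else vm).
exists (fun l => if (l < m)%N then d l else dm).
have o_sub a : symp_orth m.+1 (fun l => if (l < m)%N then u l else um)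
    (fun l => if (l < m)%N then v l else vm) a -> symp_orth m u v a.
  by move=> oa l lm; have := oa l (ltnW lm); rewrite lm.
split.
- by move=> l; rewrite ltnS => _; case: ifP => [/eig|].
- move=> l l'; rewrite !ltnS => lm lm'.
  case: ltnP => ml; case: ltnP => ml'.
  + exact: sympl.
  + have -> : (l == l') = false by rewrite ltn_eqF // (leq_trans ml).
    by have [-> ->] := ovm l ml; have [-> _] := oum l ml.
  + have -> : (l == l') = false by rewrite gtn_eqF // (leq_trans ml').
    rewrite [w um _]bformJC [w vm _]bformJC -/w [w um (u l')]bformJC -/w.
    have [-> ->] := oum l' ml'; have [_ ->] := ovm l' ml'.
    by rewrite oppr0.
  + have -> : l = l'.
      by apply/eqP; rewrite eqn_leq (leq_trans lm ml') (leq_trans lm' ml).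
    by rewrite eqxx wuv /w !bformJ_self.
- move=> l l' ll'; rewrite ltnS => lm'; case: ltnP => ml; case: ltnP => ml' //.
  + exact: dle.
  (* The maximality clause of the earlier steps, applied to the new pair, gives 2 d_l <= dm + dm. *)
  + by have := dmax l um vm ml oum ovm; rewrite wuv qum qvm; lra.
  + by have := leq_ltn_trans ll' ml'; rewrite ltnNge ml.
- move=> l a b; rewrite ltnS => lm /o_sub oa /o_sub ob; case: ltnP => ml.
    exact: dmax.
  (* The clause for the new index is the maximality of (x, y) itself. *)
  have := abmax a b oa ob => h.
  have -> : 2 * dm * w a b = (w a b * N) / s.
    by rewrite /dm; field; rewrite gt_eqF.
  by rewrite ler_pdivrMr // [leRHS]mulrC.
Qed.

Lemma partial_williamson_exists m :
  (m <= n)%N -> exists u v d, partial_williamson m u v d.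
Proof.
elim: m => [|m IH] mn; first by exists (fun=> 0), (fun=> 0), (fun=> 0).
have [u [v [d pw]]] := IH (ltnW mn).
exact: partial_williamson_step pw.
Qed.

Lemma williamson_exists : exists d, williamson_diag A d.
Proof.
have [u [v [d [eig sympl dle _]]]] := partial_williamson_exists (leqnn n).
pose U : 'M_(n + n, n) := \matrix_(r, l) u l r ord0.
pose V : 'M_(n + n, n) := \matrix_(r, l) v l r ord0.
have colU l : col l U = u l by apply/colP => r; rewrite !mxE.
have colV l : col l V = v l by apply/colP => r; rewrite !mxE.
have blockE B : (row_mx U V)^T *m B *m row_mx U V =
    block_mx (U^T *m B *m U) (U^T *m B *m V) (V^T *m B *m U) (V^T *m B *m V).
  by rewrite tr_row_mx mul_col_mx mul_col_row.
have bA x y : bform A x y = bform 1%:M x (A *m y) by rewrite bform_mulr mul1mx.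
have bJ x y : bform 1%:M x (J *m y) = w x y by rewrite bform_mulr mul1mx.
exists (\row_l d l); split.
- by move=> j; rewrite mxE; have [] := eig j (ltn_ord j).
- by move=> j l jl; rewrite !mxE dle.
exists (row_mx U V).
  rewrite /symplecticmx /= blockE; congr block_mx; apply/matrixP => l l';
    rewrite mulmx_bformE !(colU, colV) !mxE -/w;
    have [uv uu vv] := sympl l l' (ltn_ord l) (ltn_ord l').
  + exact: uu.
  + exact: uv.
  + have [vu _ _] := sympl l' l (ltn_ord l') (ltn_ord l).
    by rewrite /w bformJC -/w vu eq_sym.
  + exact: vv.
rewrite blockE; congr block_mx; apply/matrixP => l l';
  rewrite mulmx_bformE !(colU, colV) !mxE bA;
  have [_ Au Av] := eig l' (ltn_ord l');
  have [uv uu vv] := sympl l l' (ltn_ord l) (ltn_ord l');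
  have [vu _ _] := sympl l' l (ltn_ord l') (ltn_ord l).
- rewrite Au bformZr bJ uv -val_eqE /=.
  by case: eqVneq => [->|_]; rewrite ?mulr1 ?mulr0.
- by rewrite Av bformZr bJ uu mulr0.
- by rewrite Au bformZr bJ vv mulr0.
- rewrite Av bformZr bJ /w bformJC -/w vu mulrN mulNr opprK -val_eqE /= eq_sym.
  by case: eqVneq => [->|_]; rewrite ?mulr1 ?mulr0.
Qed.
End Williamson.

(** * Symplectic eigenvalues *)

Definition symp_spectrum (R : realType) n (A : 'M[R]_(n + n)) : 'rV[R]_n :=
  \row_j symp_eigenval A j.

Lemma symp_spectrumP (R : realType) n (A : 'M[R]_(n + n)) :
  posdefmx A -> williamson_diag A (symp_spectrum A).
Proof.
move=> /williamson_exists Ad.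
have -> : symp_spectrum A = xget 0 [set d | williamson_diag A d].
  by apply/rowP => j; rewrite mxE.
exact: (xgetPex 0 (P := [set d | williamson_diag A d]) Ad).
Qed.

Lemma symp_spectrum_uniq (R : realType) n (A : 'M[R]_(n + n)) d :
  posdefmx A -> williamson_diag A d -> d = symp_spectrum A.
Proof. by move=> /symp_spectrumP Ad /williamson_uniq; apply. Qed.

Lemma symp_eigenval_le (R : realType) n (A B : 'M[R]_(n + n)) j :
  posdefmx A -> posdefmx B -> (forall x, qform A x <= qform B x) ->
  symp_eigenval A j <= symp_eigenval B j.
Proof.
move=> /symp_spectrumP Ad /symp_spectrumP Bd AB.
by have := williamson_le AB Ad Bd j; rewrite !mxE.
Qed.

Lemma posdef_qform_ge0 (R : realType) m (A : 'M[R]_m) x :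
  posdefmx A -> 0 <= qform A x.
Proof.
move=> [_ A0]; have [->|x0] := eqVneq x 0; first by rewrite qform0.
exact/ltW/A0.
Qed.

Lemma posdef_line (R : realType) m (A B : 'M[R]_m) t :
  posdefmx A -> posdefmx B -> 0 <= t -> posdefmx (A + t *: B).
Proof.
move=> [Atr A0] hB t0; split; first by rewrite linearD linearZ /= Atr; case: hB => ->.
move=> x x0; rewrite -/(qform _ x) qformD qformZ ltr_pwDl //; first exact: A0.
by rewrite mulr_ge0 // posdef_qform_ge0.
Qed.

Lemma posdefZ (R : realType) m (A : 'M[R]_m) t :
  posdefmx A -> 0 < t -> posdefmx (t *: A).
Proof.
move=> [Atr A0] t0; split; first by rewrite linearZ /= Atr.
by move=> x x0; rewrite -/(qform _ x) qformZ mulr_gt0 // A0.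
Qed.

Lemma symp_eigenvalZ (R : realType) n (A : 'M[R]_(n + n)) t j :
  posdefmx A -> 0 < t -> symp_eigenval (t *: A) j = t * symp_eigenval A j.
Proof.
move=> hA t0; have [d0 dle [M MJ MA]] := symp_spectrumP hA.
suff /(symp_spectrum_uniq (posdefZ hA t0))/rowP/(_ j) :
  williamson_diag (t *: A) (t *: symp_spectrum A) by rewrite !mxE.
split=> [l|l l' ll'|]; rewrite ?mxE.
- by rewrite mulr_gt0 //; have := d0 l; rewrite mxE.
- by rewrite ler_pM2l //; have := dle _ _ ll'; rewrite !mxE.
exists M => //; rewrite -scalemxAr -scalemxAl MA scale_block_mx !scaler0.
by congr block_mx; apply/matrixP => r s; rewrite !mxE mulrnAr.
Qed.

(** * One-sided differentiation of symplectic eigenvalues *)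

Lemma symplectic_pair (R : realType) n k (M : 'M[R]_(n + n, k + k)) j :
  symplecticmx M ->
  bform (sympJ R n) (col (lshift k j) M) (col (rshift k j) M) = 1.
Proof.
by move=> MJ; rewrite -mulmx_bformE MJ /sympJ block_mxEur mxE eqxx.
Qed.

(** The inverse transpose of M is J^T M J, so A M = J^T M J [dsum d]; the two column blocks are the
    eigenvector equations. *)
Lemma williamson_cols (R : realType) n (A M : 'M[R]_(n + n)) d j :
  symplecticmx M -> M^T *m A *m M = dsum d ->
  A *m col (lshift n j) M = d ord0 j *: (sympJ R n *m col (rshift n j) M) /\
  A *m col (rshift n j) M = - d ord0 j *: (sympJ R n *m col (lshift n j) M).
Proof.
move=> MJ MA; have MK := symplectic_invr MJ.
have AM : A *m M = (sympJ R n)^T *m M *m sympJ R n *m dsum d.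
  rewrite -MA !mulmxA.
  have := congr1 trmx MK; rewrite trmx1 !trmx_mul !trmxK !mulmxA => ->.
  by rewrite mul1mx.
have colD (X : 'M[R]_(n + n, n)) : col j (X *m diag_mx d) = d ord0 j *: col j X.
  by apply/colP => r; rewrite mul_mx_diag !mxE mulrC.
move: AM; rewrite -[M]hsubmxK colKl colKr.
rewrite -mulmxA -mulmxA /sympJ /dsum mulmx_block !mulmx0 !mul0mx !addr0 !add0r.
rewrite mul1mx mulNmx mul1mx -/(sympJ R n) mul_row_block !mulmx0 addr0 add0r.
rewrite !mul_mx_row => /eq_row_mx[AU AV].
have colM p q (X : 'M[R]_(n + n, p)) (Y : 'M_(p, q)) l :
  X *m col l Y = col l (X *m Y) by rewrite !colE mulmxA.
have colN p (X : 'M[R]_(n + n, p)) l : col l (- X) = - col l X.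
  by apply/colP => r; rewrite !mxE.
rewrite sympJ_tr !mulNmx ?mulmxN ?opprK in AU AV.
rewrite !colM AU AV colN.
split; rewrite -[in LHS]colM colD -scalemxAr colM //.
by rewrite scaleNr.
Qed.

(** The first-order variation of the j-th symplectic eigenvalue in the direction B, relative to the
    basis M. *)
Definition pairmean (R : realType) n (B M : 'M[R]_(n + n)) (j : 'I_n) : R :=
  2^-1 * (qform B (col (lshift n j) M) + qform B (col (rshift n j) M)).

(* Pairing the eigenvalue equations of the two matrices crosswise, so that the
   variation of the eigenvectors does not enter. *)
Lemma williamson_secant (R : realType) n (C B M M' : 'M[R]_(n + n)) d d' s j :
  symplecticmx M -> symplecticmx M' -> C^T = C ->
  M^T *m C *m M = dsum d -> M'^T *m (C - s *: B) *m M' = dsum d' ->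
  s * ((M^T *m B *m M') (lshift n j) (lshift n j) +
       (M^T *m B *m M') (rshift n j) (rshift n j)) =
  (d ord0 j - d' ord0 j) *
      ((M^T *m sympJ R n *m M') (lshift n j) (rshift n j) -
       (M^T *m sympJ R n *m M') (rshift n j) (lshift n j)).
Proof.
move=> MJ MJ' Ctr MC MC'; rewrite !mulmx_bformE.
have [Cu Cv] := williamson_cols j MJ MC.
have [Cu' Cv'] := williamson_cols j MJ' MC'.
move: (col (lshift n j) M) (col (rshift n j) M) Cu Cv => u v Cu Cv.
move: (col (lshift n j) M') (col (rshift n j) M') Cu' Cv' => u' v' Cu' Cv'.
have e1 : bform C u u' + bform C v v' =
    d ord0 j * (bform (sympJ R n) u v' - bform (sympJ R n) v u').
  rewrite -[in LHS]Ctr -(mulmx1 C^T) -!bform_mull Cu Cv !bformZl !bform_mull.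
  by rewrite sympJ_tr !mulmx1 !bformN; ring.
have CB : C = C - s *: B + s *: B by rewrite subrK.
have e2 : bform (C - s *: B) u u' + bform (C - s *: B) v v' =
    d' ord0 j * (bform (sympJ R n) u v' - bform (sympJ R n) v u').
  rewrite -(mul1mx (C - _)) -!bform_mulr Cu' Cv' !bformZr !bform_mulr !mul1mx.
  by ring.
have bD x y : bform C x y = bform (C - s *: B) x y + s * bform B x y.
  rewrite {1}CB {1}/bform mulmxDr mulmxDl mxE.
  by rewrite -/(bform _ x y) -/(bform (s *: B) x y) bformZ.
move: e1; rewrite !bD mulrBl; lra.
Qed.

Lemma mxcvg_dsum (R : realType) T (F : set_system T) {FF : Filter F} n
    (X : T -> 'rV[R]_n) L :
  mxcvg F X L -> mxcvg F (fun s => dsum (X s)) (dsum L).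
Proof.
move=> XL r c; rewrite dsumE !mxE.
rewrite (_ : (fun s => _) = (fun s => X s ord0 (halfidx r) *+ (r == c))); last first.
  by apply/funext => s; rewrite dsumE !mxE.
by apply: cvgMn; exact: XL.
Qed.

Lemma williamson_diag_entry (R : realType) n (A M : 'M[R]_(n + n)) d r :
  M^T *m A *m M = dsum d -> qform A (col r M) = d ord0 (halfidx r).
Proof. by move=> MA; rewrite qformE -mulmx_bformE MA dsumE !mxE eqxx. Qed.

(** Each column x of M satisfies a |x|^2 <= [qform A x] <= [qform C x] <= K with a the coercivity
    constant of A. The bound depends on neither C nor M, as compactness requires. *)
Lemma williamson_bound (R : realType) n (A : 'M[R]_(n + n)) (K : R) :
  posdefmx A -> exists L : R, forall (C M : 'M[R]_(n + n)) (d : 'rV[R]_n),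
    (forall x, qform A x <= qform C x) -> M^T *m C *m M = dsum d ->
    (forall j, d ord0 j <= K) -> forall r c, `|M r c| <= L.
Proof.
move=> /posdef_coercive[a a0 aA]; exists (Num.sqrt (K / a)) => C M d AC MC dK r c.
rewrite -sqrtr_sqr ler_wsqrtr // ler_pdivlMr // mulrC.
apply: le_trans (dK (halfidx c)); rewrite -(williamson_diag_entry c MC).
apply: le_trans (AC _); apply: le_trans (aA _).
rewrite ler_pM2l // qform1 (bigD1 r) //= mxE lerDl sumr_ge0 // => l _.
by rewrite sqr_ge0.
Qed.

(** The limit is taken along an ultrafilter finer than s -> 0+, so each e yields some s, not all
    small ones. M is independent of e, and one s serves all j. *)
Lemma symp_eigenval_left_derivative (R : realType) n (A B : 'M[R]_(n + n)) t :
  posdefmx A -> posdefmx B -> 0 < t ->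
  exists M, [/\ symplecticmx M,
    M^T *m (A + t *: B) *m M = dsum (symp_spectrum (A + t *: B)) &
    forall e, 0 < e -> exists s, [/\ 0 < s, s < t & forall j,
      `|symp_eigenval (A + t *: B) j - symp_eigenval (A + (t - s) *: B) j -
        s * pairmean B M j| <= s * e]].
Proof.
move=> hA hB t0; set C := A + t *: B.
have hC : posdefmx C by apply: posdef_line => //; exact: ltW.
have CsE s : A + (t - s) *: B = C - s *: B by rewrite scalerBl addrA.
have hCs s : s < t -> posdefmx (C - s *: B).
  by move=> st; rewrite -CsE; apply: posdef_line => //; rewrite subr_ge0 ltW.
(* [W s] diagonalises C - sB; the value 0 for s >= t is a mere default. *)
have /choice[W WP] s : exists M : 'M[R]_(n + n), s < t ->
    symplecticmx M /\ M^T *m (C - s *: B) *m M = dsum (symp_spectrum (C - s *: B)).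
  have [st|_] := boolP (s < t); last by exists 0.
  by have [_ _ [M MJ MC]] := symp_spectrumP (hCs s st); exists M.
have [F [FU oF]] := @ultraFilterLemma R 0^'+ _.
have Fs : \forall s \near F, 0 < s < t.
  by apply: oF; near=> s; apply/andP; split.
have F0 : s @[s --> F] --> (0 : R).
  have r0 : s @[s --> 0^'+] --> (0 : R) by exact/cvg_at_right_filter/cvg_id.
  by move=> U U0; apply: oF; exact: r0.
have le_C s j : 0 < s < t -> symp_eigenval (C - s *: B) j <= symp_eigenval C j.
  move=> /andP[s0 st]; apply: symp_eigenval_le => //; first exact: hCs.
  by move=> x; rewrite qformB qformZ gerBl mulr_ge0 ?posdef_qform_ge0 // ltW.
have ge0 A' j : posdefmx A' -> 0 < symp_eigenval A' j.
  by move=> /symp_spectrumP[/(_ j)]; rewrite mxE.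
pose K := \sum_j symp_eigenval C j.
have le_K j : symp_eigenval C j <= K.
  by rewrite /K (bigD1 j) //= lerDl sumr_ge0 // => l _; apply/ltW/ge0.
(* C - sB = A + (t - s)B dominates A, so one bound serves all the matrices [W s]. *)
have [L LP] := williamson_bound K hA.
have [M WM] : exists M, mxcvg F W M.
  apply: (@ultra_bounded_mxcvg _ _ _ _ _ _ _ L) => r c; apply: filterS Fs => s s0t.
  have /andP[s0 st] := s0t; have [WJ WC] := WP s st.
  apply: (LP _ _ _ _ WC) => [x|j].
    by rewrite -CsE qformD qformZ lerDl mulr_ge0 ?posdef_qform_ge0 // subr_ge0 ltW.
  by rewrite mxE; apply: le_trans (le_C s j s0t) _.
have [D dD] : exists D, mxcvg F (fun s => symp_spectrum (C - s *: B)) D.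
  apply: (@ultra_bounded_mxcvg _ _ _ _ _ _ _ K) => r j; apply: filterS Fs => s s0t.
  have /andP[s0 st] := s0t; rewrite mxE ger0_norm; last exact/ltW/ge0/hCs.
  exact: le_trans (le_C s j s0t) _.
have WTW (X : R -> 'M[R]_(n + n)) Y : mxcvg F X Y ->
    mxcvg F (fun s => (W s)^T *m X s *m W s) (M^T *m Y *m M).
  by move=> XY; do 2!apply: mxcvg_mul => //; exact: mxcvg_tr.
have MTW Y : mxcvg F (fun s => M^T *m Y *m W s) (M^T *m Y *m M).
  by apply: mxcvg_mul => //; exact: mxcvg_cst.
have MJ : symplecticmx M.
  apply: (mxcvg_uniq (WTW (fun=> sympJ R n) (sympJ R n) _)) => [|r c].
    exact: mxcvg_cst.
  apply: cvg_near_eq (cvg_cst _); apply: filterS Fs => s /andP[_ st].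
  by have [-> _] := WP s st.
have MC : M^T *m C *m M = dsum D.
  apply: (mxcvg_uniq (WTW (fun s => C - s *: B) C _)) => r c.
    rewrite (_ : (fun s => _) = (fun s => C r c - s * B r c)); last first.
      by apply/funext => s; rewrite !mxE.
    rewrite -[C r c in X in _ --> X]subr0 -(mul0r (B r c)).
    by apply: cvgB; [exact: cvg_cst|apply: cvgM => //; exact: cvg_cst].
  have dDrc : dsum (symp_spectrum (C - s *: B)) r c @[s --> F] --> dsum D r c.
    exact: mxcvg_dsum.
  apply: cvg_near_eq dDrc; apply: filterS Fs => s /andP[_ st].
  by have [_ ->] := WP s st.
have DC : D = symp_spectrum C.
  apply: symp_spectrum_uniq => //; split; last by exists M.
    (* Strict positivity could be lost in the limit. It holds because D_j is the value of C on a
       column of M, nonzero as a member of a symplectic pair. *)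
    move=> j; rewrite -(halfidx_lshift j) -(williamson_diag_entry _ MC).
    case: hC => _; apply; apply/negP => /eqP u0.
    by have := symplectic_pair j MJ; rewrite u0 /bform trmx0 !mul0mx mxE; lra.
  move=> j l jl; apply: ler_cvg_to (dD ord0 j) (dD ord0 l) _.
  apply: filterS Fs => s /andP[_ st].
  by have [_ h _] := symp_spectrumP (hCs s st); exact: h.
exists M; split=> //; first by rewrite MC DC.
move=> e e0.
(* The crosswise identity reads s [bs s j] = (d_j(C) - d_j(C - sB)) [ws s j]. Along F, [bs s j]
   tends to 2 [pairmean B M j] and [ws s j] to 2. *)
pose bs (s : R) j : R := (M^T *m B *m W s) (lshift n j) (lshift n j) +
               (M^T *m B *m W s) (rshift n j) (rshift n j).
pose ws (s : R) j : R := (M^T *m sympJ R n *m W s) (lshift n j) (rshift n j) -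
               (M^T *m sympJ R n *m W s) (rshift n j) (lshift n j).
have wsj j : ws s j @[s --> F] --> (2 : R).
  have -> : 2 = (M^T *m sympJ R n *m M) (lshift n j) (rshift n j) -
                (M^T *m sympJ R n *m M) (rshift n j) (lshift n j).
    by rewrite !mulmx_bformE [X in _ - X]bformJC (symplectic_pair j MJ); lra.
  by apply: cvgB; exact: MTW.
have bsj j : bs s j / ws s j @[s --> F] --> pairmean B M j.
  rewrite /pairmean mulrC !qformE -!mulmx_bformE.
  apply: cvgM; first by apply: cvgD; exact: MTW.
  by apply: cvgV; [rewrite pnatr_eq0|exact: wsj].
have : \forall s \near F, forall j, 0 < ws s j /\
    `|pairmean B M j - bs s j / ws s j| < e.
  apply: filter_forall => j; apply: filterI.
    exact: (cvgr_gt _ (wsj j)).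
  by have /cvgrPdist_lt/(_ e e0) := bsj j.
move=> /(filterI Fs)/filter_ex[s [/andP[s0 st] sP]]; exists s; split=> // j.
have [w0 we] := sP j; have [WJ WC] := WP s st.
have := williamson_secant j MJ WJ (proj1 hC) MC WC.
rewrite -/(bs s j) -/(ws s j) DC !mxE -CsE => sec.
have -> : symp_eigenval C j - symp_eigenval (A + (t - s) *: B) j =
    s * (bs s j / ws s j) by rewrite mulrA sec mulfK ?gt_eqF.
rewrite -mulrBr normrM (gtr0_norm s0) distrC.
by rewrite ler_pM2l // ltW.
Unshelve. all: by end_near. Qed.

(** * The Lidskii-type inequality *)

Definition pair_index (n k : nat) (i : 'I_k -> 'I_n) (c : 'I_(k + k)) : 'I_(n + n) :=
  match fintype.split c with
  | inl j => lshift n (i j)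
  | inr j => rshift n (i j)
  end.

Lemma pair_index_lshift n k (i : 'I_k -> 'I_n) j :
  pair_index i (lshift k j) = lshift n (i j).
Proof. by rewrite /pair_index (unsplitK (inl _ j)). Qed.

Lemma pair_index_rshift n k (i : 'I_k -> 'I_n) j :
  pair_index i (rshift k j) = rshift n (i j).
Proof. by rewrite /pair_index (unsplitK (inr _ j)). Qed.

Lemma colsub_congr (R : realType) m p q (B : 'M[R]_m) (M : 'M[R]_(m, p))
    (f : 'I_q -> 'I_p) :
  (colsub f M)^T *m B *m colsub f M = mxsub f f (M^T *m B *m M).
Proof.
apply/matrixP => r s; rewrite [RHS]mxE !mulmx_bformE.
by congr bform; apply/colP => c; rewrite !mxE.
Qed.

Lemma colsub_symplectic (R : realType) n k (i : 'I_k -> 'I_n) (M : 'M[R]_(n + n)) :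
  injective i -> symplecticmx M -> symplecticmx (colsub (pair_index i) M).
Proof.
move=> iI MJ; rewrite /symplecticmx /= colsub_congr MJ.
apply/matrixP => r s; rewrite mxE -[r]splitK -[s]splitK /sympJ.
case: (fintype.split r) => j; case: (fintype.split s) => l /=;
  rewrite ?(pair_index_lshift, pair_index_rshift)
    ?(block_mxEul, block_mxEur, block_mxEdl, block_mxEdr) !mxE ?(inj_eq iI) //.
Qed.

Lemma colsub_trace (R : realType) n k (i : 'I_k -> 'I_n) (B M : 'M[R]_(n + n)) :
  \tr ((colsub (pair_index i) M)^T *m B *m colsub (pair_index i) M) =
  2 * \sum_j pairmean B M (i j).
Proof.
rewrite colsub_congr /mxtrace.
rewrite (eq_bigr (fun c => qform B (col (pair_index i c) M))); last first.
  by move=> c _; rewrite mxE mulmx_bformE.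
rewrite big_split_ord /= mulr_sumr -big_split /=; apply: eq_bigr => j _.
by rewrite pair_index_lshift pair_index_rshift /pairmean mulVKf // pnatr_eq0.
Qed.

Lemma eigenpair_cols_trace (R : realType) n k (i : 'I_k -> 'I_n)
    (C : 'M[R]_(n + n)) (M : 'M[R]_(n + n, k + k)) :
  symplecticmx M -> symp_eigenpair_cols C i M ->
  \tr (M^T *m C *m M) = 2 * \sum_j symp_eigenval C (i j).
Proof.
move=> MJ MC; rewrite /mxtrace big_split_ord /= mulr_sumr -big_split /=.
apply: eq_bigr => j _; rewrite !mulmx_bformE; have [_ _ Cu Cv] := MC j.
rewrite -(mul1mx C) -!bform_mulr Cu Cv !bformZr !bform_mulr !mul1mx.
by rewrite [bform _ (col (rshift k j) M) _]bformJC (symplectic_pair j MJ); lra.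
Qed.

Section Lidskii.
Variables (R : realType) (n k : nat) (i : 'I_k -> 'I_n).
Hypotheses (k0 : (0 < k)%N) (iI : injective i).
Implicit Types A B : 'M[R]_(n + n).

Lemma pairmean_sum_ge B M : posdefmx B -> symplecticmx M ->
  \sum_(j < n | (j < k)%N) symp_eigenval B j <= \sum_j pairmean B M (i j).
Proof.
move=> /symp_spectrumP hB /(colsub_symplectic iI) NJ.
have := williamson_kyfan k0 NJ hB; rewrite colsub_trace.
by under eq_bigr do rewrite mxE; lra.
Qed.

Lemma pairmean_sum_secant A B M t e s :
  (forall j, `|symp_eigenval (A + t *: B) j - symp_eigenval (A + (t - s) *: B) j -
        s * pairmean B M j| <= s * (e / k%:R)) ->
  `|\sum_j symp_eigenval (A + t *: B) (i j) -
    \sum_j symp_eigenval (A + (t - s) *: B) (i j) -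
    s * \sum_j pairmean B M (i j)| <= s * e.
Proof.
move=> h; rewrite mulr_sumr -!sumrB; apply: le_trans (ler_norm_sum _ _ _) _.
apply: le_trans (ler_sum _ (fun j _ => h (i j))) _.
rewrite sumr_const card_ord -[leLHS]mulr_natr -mulrA divfK //.
by rewrite pnatr_eq0 -lt0n.
Qed.

(** Every point s > 0 has points to its left from which f grows at rate at least S - d, for any
    slack d > 0. An infimum argument carries this bound from t down to 0. *)
Lemma lidskii A B t : posdefmx A -> posdefmx B -> 0 <= t ->
  \sum_j symp_eigenval A (i j) +
    t * \sum_(j < n | (j < k)%N) symp_eigenval B j <=
  \sum_j symp_eigenval (A + t *: B) (i j).
Proof.
move=> hA hB t0; set S := (X in t * X).
pose f s := \sum_j symp_eigenval (A + s *: B) (i j).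
have f_mono s s' : 0 <= s -> s <= s' -> f s <= f s'.
  move=> s0 ss'; apply: ler_sum => j _; apply: symp_eigenval_le.
  - exact: posdef_line.
  - by apply: posdef_line => //; exact: le_trans ss'.
  by move=> x; rewrite !qformD !qformZ lerD2l ler_wpM2r // posdef_qform_ge0.
have -> : \sum_j symp_eigenval A (i j) = f 0.
  by rewrite /f scale0r addr0.
rewrite -/(f t); apply/ler_addgt0Pr => e e0.
(* Chosen so that the total loss t d is at most e; t + 1 avoids dividing by t = 0. *)
pose d := e / (t + 1); have t1 : 0 < t + 1 by rewrite ltr_wpDl.
have d0 : 0 < d by rewrite divr_gt0.
suff : f 0 <= f t - t * (S - d).
  have : t * d <= e by rewrite /d mulrA ler_pdivrMr // mulrC ler_pM2l // lerDl.
  by rewrite mulrBr; lra.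
pose T := [set s | 0 <= s <= t /\ f s - s * (S - d) <= f t - t * (S - d)]%classic.
have Tt : T t by rewrite /T /= t0 lexx.
have lbT : lbound T 0 by move=> s [/andP[]].
have infT : has_inf T by split; [exists t|exists 0].
pose m := inf T.
have m0 : 0 <= m by apply: lb_le_inf => //; exists t.
have mt : m <= t by apply: ge_inf => //; exists 0.
(* The infimum belongs to T without continuity of f: for s in T just above m, f m <= f s by
   monotonicity, and the linear term changes by less than the supposed gap g. *)
have Tm : f m - m * (S - d) <= f t - t * (S - d).
  rewrite leNgt; apply/negP => lt_m.
  pose g := f m - m * (S - d) - (f t - t * (S - d)).
  have g0 : 0 < g by rewrite subr_gt0.
  have c0 : 0 < `|S - d| + 1 by rewrite ltr_wpDl.
  have [s [/andP[s0 st] sT] sm] := inf_adherent (divr_gt0 g0 c0) infT.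
  have ms : m <= s by apply: ge_inf; [exists 0|split=> //; rewrite s0].
  have := f_mono _ _ m0 ms; rewrite -/m in sm.
  have : (s - m) * (S - d) <= (s - m) * (`|S - d| + 1).
    by rewrite ler_wpM2l ?subr_ge0 // (le_trans (ler_norm _)) // lerDl.
  have : (s - m) * (`|S - d| + 1) < g by rewrite -ltr_pdivlMr // ltrBlDl.
  by rewrite /g mulrBl; lra.
have [m_eq0|mn0] := eqVneq m 0; first by move: Tm; rewrite m_eq0; lra.
have m_gt0 : 0 < m by rewrite lt_def mn0.
have [M [MJ _ MP]] := symp_eigenval_left_derivative hA hB m_gt0.
have kR : 0 < k%:R :> R by rewrite ltr0n.
have [s [s0 sm /pairmean_sum_secant]] := MP _ (divr_gt0 d0 kR).
rewrite -/(f m) -/(f (m - s)) ler_norml => /andP[h _].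
have := pairmean_sum_ge hB MJ; rewrite -/S -(ler_pM2l s0) => h'.
(* If m > 0, the left difference at m puts m - s in T, against the choice of m. *)
have /(ge_inf (proj2 infT)) : T (m - s).
  split; first by rewrite subr_ge0 ltW //= (le_trans _ mt) // gerBl ltW.
  by move: Tm h h'; rewrite !mulrBl mulrBr; lra.
by rewrite -/m; lra.
Qed.

Lemma lidskii_line A B s t : posdefmx A -> posdefmx B -> 0 <= s -> s <= t ->
  \sum_j symp_eigenval (A + s *: B) (i j) +
    (t - s) * \sum_(j < n | (j < k)%N) symp_eigenval B j <=
  \sum_j symp_eigenval (A + t *: B) (i j).
Proof.
move=> hA hB s0 st; have hs := posdef_line hA hB s0.
have ts0 : 0 <= t - s by rewrite subr_ge0.
have := lidskii hs hB ts0.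
by rewrite -addrA -scalerDl [s + _]addrC subrK.
Qed.

End Lidskii.

(** * The theorem *)

Theorem theorem2 (R : realType) (n k : nat) (A B : 'M[R]_(n + n))
    (hA : posdefmx A) (hB : posdefmx B)
    (i : 'I_k -> 'I_n) (hk : (0 < k)%N)
    (hi : forall j l : 'I_k, (j < l)%N -> (i j < i l)%N) :
  [<->
    (* (i) *)
    \sum_(j < k) symp_eigenval (A + B) (i j) =
      \sum_(j < k) symp_eigenval A (i j) +
      \sum_(j < n | (j < k)%N) symp_eigenval B j;
    (* (ii) *)
    forall t : R, 0 <= t <= 1 ->
      \sum_(j < k) symp_eigenval (A + t *: B) (i j) =
        \sum_(j < k) symp_eigenval A (i j) +
        t * \sum_(j < n | (j < k)%N) symp_eigenval B j;
    (* (iii) *)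
    exists (r : nat) (a : nat -> R),
      [/\ (0 < r)%N, a 0%N = 0, a r = 1,
          forall l : nat, (l < r)%N -> a l < a l.+1
        & forall (l : nat) (t : R), (l < r)%N -> a l < t < a l.+1 ->
            exists M : 'M[R]_(n + n, k + k),
              [/\ symplecticmx M,
                  symp_eigenpair_cols (A + t *: B) i M,
                  \tr (M^T *m A *m M) =
                    2 * \sum_(j < k) symp_eigenval A (i j)
                & \tr (M^T *m B *m M) =
                    2 * \sum_(j < n | (j < k)%N) symp_eigenval B j]]].
Proof.
have iI : injective i.
  move=> j l ijl; apply/val_inj/eqP; rewrite eqn_leq leqNgt [(l <= j)%N]leqNgt.
  by apply/andP; split; apply/negP => /hi; rewrite ijl ltnn.
set S := \sum_(j < n | _) _.
tfae.
(* The lower bounds on [0, t] and [t, 1] add up to the equality assumed at 1, so both are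
   equalities. *)
- move=> h t /andP[t0 t1].
  have := lidskii hk iI hA hB t0; have := lidskii_line hk iI hA hB t0 t1.
  by rewrite -/S scale1r h => h1 h2; apply/eqP; rewrite eq_le h2 andbT; lra.
- move=> h; exists 1%N, (fun l => l%:R); split=> //.
    by move=> l; rewrite ltnS leqn0 => /eqP ->; rewrite ltr01.
  move=> l t; rewrite ltnS leqn0 => /eqP -> /andP[t0 t1].
  have ht := posdef_line hA hB (ltW t0).
  have [M [MJ MC MP]] := symp_eigenval_left_derivative hA hB t0.
  have [d0 _ _] := symp_spectrumP ht.
  (* Under (ii) the difference quotients of the sum equal S exactly, so the pair means differ from S
     by at most any e > 0. *)
  have bS : \sum_j pairmean B M (i j) = S.
    apply/eqP; rewrite -subr_eq0 -normr_le0; apply/ler_addgt0Pr => e e0.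
    rewrite add0r.
    have [|s [s0 st /(pairmean_sum_secant i hk)]] := MP (e / k%:R).
      by rewrite divr_gt0 // ltr0n.
    rewrite !h; last 2 first.
    - by rewrite subr_ge0 (ltW st) lerBlDr (le_trans (ltW t1)) // lerDl ltW.
    - by rewrite (ltW t0) ltW.
    rewrite -/S (_ : _ - _ - _ = s * (S - \sum_j pairmean B M (i j))); last by ring.
    by rewrite normrM gtr0_norm // ler_pM2l // distrC.
  have trB : \tr ((colsub (pair_index i) M)^T *m B *m colsub (pair_index i) M) = 2 * S.
    by rewrite colsub_trace bS.
  exists (colsub (pair_index i) M); split=> //.
  + exact: colsub_symplectic.
  + move=> j; rewrite !col_colsub pair_index_lshift pair_index_rshift.
    have [Cu Cv] := williamson_cols (i j) MJ MC.
    have uv := symplectic_pair (i j) MJ; rewrite mxE in Cu Cv.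
    split=> //; apply/eqP => u0; move: uv.
      by rewrite u0 /bform trmx0 !mul0mx mxE; lra.
    by rewrite u0 /bform mulmx0 mxE; lra.
  (* The trace of A is that of A + tB, known from the diagonal form, minus t times that of B. *)
  + have : \tr ((colsub (pair_index i) M)^T *m (A + t *: B) *m
                 colsub (pair_index i) M) =
        2 * \sum_j symp_eigenval (A + t *: B) (i j).
      rewrite colsub_trace; congr (_ * _); apply: eq_bigr => j _.
      rewrite /pairmean !(williamson_diag_entry _ MC).
      by rewrite halfidx_lshift halfidx_rshift mxE; lra.
    rewrite mulmxDr mulmxDl mxtraceD -scalemxAr -scalemxAl mxtraceZ trB h; first by lra.
    by rewrite (ltW t0) ltW.
- move=> [r [a [r0 _ ar a_inc aP]]].
  (* Only the last interval, which ends at 1, is used. *)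
  have r1 : (r.-1 < r)%N by rewrite prednK.
  have a1 : a r.-1 < 1 by have := a_inc _ r1; rewrite prednK // ar.
  have hAB : posdefmx (A + B) by rewrite -(scale1r B); apply: posdef_line.
  have fE t : a r.-1 < t -> t < 1 -> \sum_j symp_eigenval (A + t *: B) (i j) =
      \sum_j symp_eigenval A (i j) + t * S.
    move=> at1 t1; have [|M [MJ Mcols trA trB]] := aP _ t r1.
      by rewrite at1 prednK // ar.
    have := eigenpair_cols_trace MJ Mcols.
    rewrite mulmxDr mulmxDl mxtraceD -scalemxAr -scalemxAl mxtraceZ trA trB -/S.
    by lra.
  have upper t : 0 < t -> a r.-1 < t -> t < 1 ->
      t * \sum_j symp_eigenval (A + B) (i j) <= \sum_j symp_eigenval A (i j) + t * S.
    move=> t0 at1 t1; rewrite -fE // mulr_sumr ler_sum // => j _.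
    rewrite -symp_eigenvalZ //; apply: symp_eigenval_le.
    + exact: posdefZ.
    + by apply: posdef_line => //; exact: ltW.
    move=> x; rewrite scalerDr !qformD !qformZ lerD2r.
    by rewrite ler_piMl ?posdef_qform_ge0 // ltW.
  apply/eqP; rewrite eq_le; apply/andP; split; last first.
    by have := lidskii hk iI hA hB ler01; rewrite scale1r mul1r.
  rewrite leNgt; apply/negP => lt_sum.
  set F := \sum_j symp_eigenval (A + B) _ in upper lt_sum.
  set L := \sum_j symp_eigenval A _ in upper lt_sum.
  have L0 : 0 <= L.
    apply: sumr_ge0 => j _; have [d0 _ _] := symp_spectrumP hA.
    by have /ltW := d0 (i j); rewrite mxE.
  have G0 : 0 < F - S by lra.
  (* If F > L + S then L / (F - S) < 1. Any t in (b, 1) is positive, lies in the last interval and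
     has t (F - S) > L, against [upper]; the midpoint of b and 1 is such a t. *)
  pose b := Num.max (Num.max 0 (a r.-1)) (L / (F - S)).
  have b1 : b < 1.
    by rewrite !gt_max ltr01 a1 ltr_pdivrMr // mul1r; lra.
  have [b0 ba bL] : [/\ 0 <= b, a r.-1 <= b & L / (F - S) <= b].
    by rewrite !le_max !lexx !orbT.
  have := upper ((b + 1) / 2); rewrite ler_pdivrMr // in bL *.
  have h1 : 0 < (b + 1) / 2 by lra.
  have h2 : a r.-1 < (b + 1) / 2 by lra.
  have h3 : (b + 1) / 2 < 1 by lra.
  move=> /(_ h1 h2 h3); apply/negP; rewrite -ltNge.
  have : (b + 1) / 2 * (F - S) > b * (F - S) by rewrite ltr_pM2r //; lra.
  by rewrite !mulrBr; lra.
Qed.
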